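(* Let $d\in\mathbb{N}$, let $\mu>0$, and let $a\in L^\infty(\mathbb{R}^d/\mathbb{Z}^d)^{d\times d}$ be a real symmetric-matrix-valued coefficient field such that, for constants $\lambda,\Lambda>1$, $\lambda^{-1}|\xi|^2\le \xi\cdot a(x)\xi\le \Lambda|\xi|^2$ for all $\xi\in\mathbb{R}^d$ and all $x\in\mathbb{R}^d/\mathbb{Z}^d$. Then the operator $\hat a * + \mu\hat p$ on $\big(\ell^2((2\pi\mathbb{Z})^d)\big)^d$, $\hat\psi\mapsto \hat a*\hat\psi+\mu\,\hat p\,\hat\psi$, is symmetric (i.e. self-adjoint for the Hermitian inner product) and positive definite. Moreover, its condition number $C$ satisfies $$C\le \lambda(\mu+\Lambda).$$
   Context: $\hat a(k)$, $k\in(2\pi\mathbb{Z})^d$, denotes the ($d\times d$ matrix-valued) Fourier coefficients of $a$ on the unit periodic cube $\mathbb{R}^d/\mathbb{Z}^d$. The discrete convolution is $(\hat a*\hat\psi)_i(k)=\sum_{j}\sum_{k'\in(2\pi\mathbb{Z})^d}\hat a_{ij}(k-k')\hat\psi_j(k')$, so that $\hat a*$ is the conjugate, under the Fourier transform (normalized to be an isometry from $L^2$ to $\ell^2$), of the multiplication operator $\psi\mapsto a\psi$. The multiplier $\hat p$ is the pointwise matrix multiplication $(\hat p\hat\psi)_i(k)=\sum_j\hat p_{ij}(k)\hat\psi_j(k)$ with $\hat p_{ij}(k)=\delta_{ij}-\frac{k_ik_j}{|k|^2}$ for $k\neq0$ and $\hat p_{ij}(0)=\delta_{ij}$. The inner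 product is $\langle\hat u,\hat v\rangle=\sum_k\hat u^\dagger(k)\cdot\hat v(k)$, where $\dagger$ is the Hermitian transpose. The condition number of a bounded invertible operator $T$ is $\|T\|\,\|T^{-1}\|$ in the operator norm of $\ell^2$. *)

(* Defs.v *)
From HB Require Import structures.
From mathcomp Require Import all_boot all_order all_algebra.
From mathcomp Require Import complex.
From mathcomp Require Import all_classical all_reals all_analysis.

Set Implicit Arguments.
Unset Strict Implicit.
Unset Printing Implicit Defensive.

Import Order.TTheory GRing.Theory Num.Theory.
Import numFieldNormedType.Exports.
Import ComplexField.

Local Open Scope classical_set_scope.
Local Open Scope ring_scope.
Local Open Scope complex_scope.

(* Conventions. A point of R^d is a d.-tuple, the type on which the library
   puts the product Borel sigma-algebra. A frequency k in (2 pi Z)^d is indexed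
   by the integer vector n with k = 2 pi n. A function on the torus R^d / Z^d
   is a Z^d-periodic function on R^d, integrated over the unit cube. *)

Section cube_measure.
Variable R : realType.
Local Notation T := (measurableTypeR R).

Definition cons_pair n (p : T * n.-tuple T) : n.+1.-tuple T :=
  [tuple of p.1 :: p.2].

Lemma measurable_cons_pair n : measurable_fun [set: T * n.-tuple T] (@cons_pair n).
Proof. by apply: measurable_cons. Qed.

HB.instance Definition _ n :=
  isMeasurableFun.Build _ _ _ _ (@cons_pair n) (@measurable_cons_pair n).

(* Lebesgue measure on [0, 1]^n: the n-fold product of Lebesgue measure on
   [0, 1], extended by 0 outside the cube. *)
Fixpoint cube_measure n : probability (n.-tuple T) R :=
  match n with
  | 0 => \d_([tuple] : 0.-tuple T)
  | m.+1 => distribution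
      (uniform_prob (@ltr01 R) \x cube_measure m)%E (@cons_pair m)
  end.

End cube_measure.

Section torus.
Variables (R : realType) (d : nat).
Local Notation point := (d.-tuple (measurableTypeR R)).

Definition translate (x : point) (n : 'rV[int]_d) : point :=
  [tuple tnth x i + (n 0 i)%:~R | i < d].

Definition torus_periodic (S : Type) (f : point -> S) : Prop :=
  forall x n, f (translate x n) = f x.

Definition torus_Linfty_mx (a : point -> 'M[R]_d) : Prop :=
  torus_periodic a /\
  forall i j, (fun x => a x i j) \in Lfun (cube_measure R d) +oo%E.

Definition dotv (u v : 'cV[R]_d) : R := (u^T *m v) 0 0.

(* An element of L^oo is an almost-everywhere class, so the pointwise
   conditions on the coefficient field are imposed almost everywhere. *)
Definition symmetric_field (a : point -> 'M[R]_d) : Prop :=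
  {ae cube_measure R d, forall x, (a x)^T = a x}.

Definition elliptic_field (lambda Lambda : R) (a : point -> 'M[R]_d) : Prop :=
  {ae cube_measure R d, forall x, forall xi : 'cV[R]_d,
    lambda^-1 * dotv xi xi <= dotv xi (a x *m xi) <= Lambda * dotv xi xi}.

Definition wavevector (n : 'rV[int]_d) : 'cV[R]_d :=
  \col_i (2 * pi * (n 0 i)%:~R).

Definition cis (t : R) : R[i] := cos t +i* sin t.

Definition torus_cintegral (f : point -> R[i]) : R[i] :=
  (\int[cube_measure R d]_x complex.Re (f x)) +i*
  (\int[cube_measure R d]_x complex.Im (f x)).

Definition fourier_coef (f : point -> R[i]) (n : 'rV[int]_d) : R[i] :=
  torus_cintegral (fun x =>
    f x * cis (- \sum_(i < d) wavevector n i 0 * tnth x i)).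

Definition fourier_mx (a : point -> 'M[R]_d) (n : 'rV[int]_d) : 'M[R[i]]_d :=
  \matrix_(i, j) fourier_coef (fun x => (a x i j)%:C) n.

End torus.

Section sums.
Variables (R : realType) (I : choiceType).

(* Unordered sums: [esum] is meaningful on nonnegative families only, hence the
   splitting. These are the values of absolutely convergent series. *)
Definition rsum (f : I -> R) : R :=
  fine (\esum_(k in [set: I]) (Num.max (f k) 0)%:E) -
  fine (\esum_(k in [set: I]) (Num.max (- f k) 0)%:E).

Definition csum (f : I -> R[i]) : R[i] :=
  rsum (fun k => complex.Re (f k)) +i* rsum (fun k => complex.Im (f k)).

Definition abs_summable (f : I -> R[i]) : Prop :=
  summable [set: I] (fun k => (Normc.normc (f k))%:E).

End sums.

Section l2.
Variables (R : realType) (d : nat).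
Local Notation Seq := ('rV[int]_d -> 'cV[R[i]]_d).

Definition hermitian_dot (u v : 'cV[R[i]]_d) : R[i] :=
  ((map_mx conjc u)^T *m v) 0 0.

Definition l2_dot (u v : Seq) : R[i] :=
  csum (fun n => hermitian_dot (u n) (v n)).

Definition l2_norm (u : Seq) : \bar R :=
  ((\esum_(n in [set: 'rV[int]_d])
      (\sum_(i < d) Normc.normc (u n i 0) ^+ 2)%:E) `^ 2^-1)%E.

Definition l2 : set Seq := [set u | (l2_norm u < +oo)%E].

Definition op_norm (T : Seq -> Seq) : \bar R :=
  ereal_sup [set l2_norm (T u) | u in [set u | (l2_norm u <= 1)%E]].

Definition l2_operator (T : Seq -> Seq) : Prop :=
  set_fun l2 l2 T /\
  forall (c : R[i]) (u v : Seq), l2 u -> l2 v -> T (c *: u + v) = c *: T u + T v.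

Definition l2_bounded (T : Seq -> Seq) : Prop := (op_norm T < +oo)%E.

Definition l2_symmetric (T : Seq -> Seq) : Prop :=
  forall u v, l2 u -> l2 v -> l2_dot (T u) v = l2_dot u (T v).

(* In the order of R[i], [0 < z] says that z is real and positive. *)
Definition l2_posdef (T : Seq -> Seq) : Prop :=
  forall u, l2 u -> u != 0 -> 0 < l2_dot u (T u).

Definition l2_inv (T : Seq -> Seq) : Seq -> Seq := 'pinv_(fun=> 0) l2 T.

Definition l2_invertible (T : Seq -> Seq) : Prop :=
  set_bij l2 l2 T /\ l2_bounded (l2_inv T).

Definition condition_number (T : Seq -> Seq) : \bar R :=
  (op_norm T * op_norm (l2_inv T))%E.

End l2.

Section operator.
Variables (R : realType) (d : nat).
Local Notation Seq := ('rV[int]_d -> 'cV[R[i]]_d).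

Definition conv_term (b : 'rV[int]_d -> 'M[R[i]]_d) (psi : Seq)
    (n : 'rV[int]_d) (i j : 'I_d) (m : 'rV[int]_d) : R[i] :=
  b (n - m) i j * psi m j 0.

Definition discrete_conv (b : 'rV[int]_d -> 'M[R[i]]_d) (psi : Seq) : Seq :=
  fun n => \col_i \sum_(j < d) csum (conv_term b psi n i j).

Definition multiplier_mx (n : 'rV[int]_d) : 'M[R]_d :=
  let k := wavevector R n in
  \matrix_(i, j) ((i == j)%:R - (if n == 0 then 0 else k i 0 * k j 0 / dotv k k)).

Definition multiplier (psi : Seq) : Seq :=
  fun n => map_mx (real_complex R) (multiplier_mx n) *m psi n.

Definition precond_op (a : d.-tuple (measurableTypeR R) -> 'M[R]_d) (mu : R)
    (psi : Seq) : Seq :=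
  discrete_conv (fourier_mx a) psi + mu%:C *: multiplier psi.

End operator.

(* Main.v *)
Require Import Defs.
From mathcomp Require Import all_boot all_order all_algebra.
From mathcomp Require Import complex finmap.
From mathcomp Require Import all_classical all_reals all_analysis.
From mathcomp Require Import measurable_realfun.
From mathcomp Require Import ring lra.
From mathcomp.analysis.showcase Require summability.
Import Order.TTheory GRing.Theory Num.Theory.
Import numFieldNormedType.Exports.
Local Open Scope classical_set_scope.
Local Open Scope ring_scope.

(** The operator is an infinite Hermitian matrix of [d] x [d] blocks indexed by
    frequencies, [M n m = fourier_mx a (n - m)] plus the diagonal blocks
    [mu p(n)], and the proof reads everything off its finite sections.

    The sections lie between [lambda^-1] and [mu + Lambda].  For a finitely
    supported [u], let [psi] be the trigonometric polynomial with coefficients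
    [u].  The quadratic form of the convolution part at [u] is the integral of
    [psi^* a psi] ([form_fourier]), because conjugating by plane waves shifts
    frequencies.  Ellipticity bounds the integrand between [lambda^-1 |psi|^2]
    and [Lambda |psi|^2] at almost every point, and [|psi|^2] integrates to the
    sum of the [|u n|^2] by orthonormality of the characters of the torus
    ([Rintegral_sq_trig_poly]).  Each [p(n)] is an orthogonal projection, so
    the diagonal adds between [0] and [mu |u|^2] ([precond_bounds]).

    A Hermitian matrix with sections between [alpha > 0] and [beta] defines an
    operator on l2.  Nonnegativity of the form at [beta y - x] bounds its
    off-diagonal values ([form_young]); hence the rows converge absolutely
    ([kernel_row_le]), the operator has norm at most [beta] ([op_l2_le]), and
    the finite sections of the form converge to the form of the operator
    ([form_cvg]).  Symmetry and the lower bound [alpha] survive in the limit.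

    A bounded coercive operator is onto, as shown by a relaxed fixed point
    iteration ([coercive_surjective]), and its inverse has norm at most
    [alpha^-1].  With [alpha = lambda^-1] and [beta = mu + Lambda] the product
    of the two norms is at most [lambda (mu + Lambda)].

    Throughout, C^d is treated as a real Euclidean space for the real part of
    the Hermitian product; the imaginary part of [<x, y>] is the real part of
    [<x, - i y>], so complex statements follow by complex linearity. *)

(** * Unordered sums as limits along finite sets *)
Local Notation totally := summability.totally.
Local Existing Instance summability.totally_filter.

Section unordered_sums.
Set Implicit Arguments.
Unset Strict Implicit.
Context {R : realType} {I : choiceType}.
Implicit Types (f g : I -> R) (F G : {fset I}).

(** The filter [totally] makes unordered sums ordinary limits, to which the
    limit laws apply. *)
Definition has_sum f (s : R) : Prop :=
  (fun F : {fset I} => \sum_(i <- F) f i) @ totally --> s.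

Lemma has_sum_unique f s t : has_sum f s -> has_sum f t -> s = t.
Proof. by move=> fs ft; apply: cvg_unique fs ft. Qed.

Lemma eq_has_sum f g s : f =1 g -> has_sum f s -> has_sum g s.
Proof. by move=> /funext ->. Qed.

Lemma has_sumD f g s t :
  has_sum f s -> has_sum g t -> has_sum (fun i => f i + g i) (s + t).
Proof.
move=> fs gt; rewrite /has_sum.
rewrite (_ : (fun F => _) = (fun F : {fset I} => \sum_(i <- F) f i) \+
  (fun F : {fset I} => \sum_(i <- F) g i)).
  exact: cvgD.
by apply/funext => F /=; rewrite big_split.
Qed.

Lemma has_sumZ (c : R) f s : has_sum f s -> has_sum (fun i => c * f i) (c * s).
Proof.
move=> fs; rewrite /has_sum.
rewrite (_ : (fun F => _) = fun F : {fset I} => c * \sum_(i <- F) f i).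
  exact: cvgMr.
by apply/funext => F /=; rewrite mulr_sumr.
Qed.

Lemma has_sumN f s : has_sum f s -> has_sum (fun i => - f i) (- s).
Proof.
by move=> /(@has_sumZ (-1) _ _); rewrite mulN1r; apply: eq_has_sum => i;
  rewrite mulN1r.
Qed.

Lemma has_sumB f g s t :
  has_sum f s -> has_sum g t -> has_sum (fun i => f i - g i) (s - t).
Proof. by move=> fs /has_sumN; apply: has_sumD. Qed.

Lemma has_sum0 : has_sum (fun=> 0) 0.
Proof.
rewrite /has_sum (_ : (fun F => _) = fun=> 0); first exact: cvg_cst.
by apply/funext => F; rewrite big1.
Qed.

Lemma has_sum_sum (K : Type) (r : seq K) (f : K -> I -> R) (s : K -> R) :
  (forall k, has_sum (f k) (s k)) ->
  has_sum (fun i => \sum_(k <- r) f k i) (\sum_(k <- r) s k).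
Proof.
move=> fs; elim: r => [|k r IH].
  by rewrite big_nil; apply: eq_has_sum has_sum0 => i; rewrite big_nil.
rewrite big_cons; apply: eq_has_sum (has_sumD (fs k) IH) => i.
by rewrite big_cons.
Qed.

Lemma sum_fset_indic F G f : (F `<=` G)%fset ->
  \sum_(i <- G) (if i \in F then f i else 0) = \sum_(i <- F) f i.
Proof.
move=> FG; rewrite -(big_fset_incl _ FG); last by move=> i _ /negbTE ->.
by rewrite big_seq [RHS]big_seq; apply: eq_bigr => i ->.
Qed.

Lemma has_sum_fset F f :
  has_sum (fun i => if i \in F then f i else 0) (\sum_(i <- F) f i).
Proof. by apply: cvg_near_cst; exists F => //= G /sum_fset_indic ->. Qed.

Lemma le_sum_fset F G f : (F `<=` G)%fset -> (forall i, 0 <= f i) ->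
  \sum_(i <- F) f i <= \sum_(i <- G) f i.
Proof.
by move=> FG f0; rewrite -(sum_fset_indic _ FG) ler_sum // => i _; case: ifP.
Qed.

Lemma has_sum_ge f s F :
  has_sum f s -> (forall i, 0 <= f i) -> \sum_(i <- F) f i <= s.
Proof.
move=> fs f0; apply: (cvgr_to_ge fs).
by exists F => //= G FG; exact: le_sum_fset.
Qed.

Lemma has_sum_le f s (C : R) :
  has_sum f s -> (forall F, \sum_(i <- F) f i <= C) -> s <= C.
Proof.
by move=> fs fC; apply: (cvgr_to_le fs); exists fset0.
Qed.

Lemma sum_le_esum f F : (forall i, 0 <= f i) ->
  ((\sum_(i <- F) f i)%:E <= \esum_(i in [set: I]) (f i)%:E)%E.
Proof.
move=> f0; apply: esum_ge; exists [set` F]; first by split => //.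
by rewrite fsbig_finite//= set_fsetK sumEFin.
Qed.

Lemma esum_le f (C : R) :
  (forall F, \sum_(i <- F) f i <= C) ->
  (\esum_(i in [set: I]) (f i)%:E <= C%:E)%E.
Proof.
move=> fC; apply: ge_ereal_sup => _ [X [finX _]] <-.
by rewrite fsbig_finite//= sumEFin lee_fin.
Qed.

Lemma nonneg_has_sum f (C : R) : (forall i, 0 <= f i) ->
  (forall F, \sum_(i <- F) f i <= C) ->
  has_sum f (fine (\esum_(i in [set: I]) (f i)%:E)).
Proof.
move=> f0 fC; have sC := esum_le fC; set S := esum _ _ in sC *.
have S0 : (0 <= S)%E by apply: esum_ge0 => i _; rewrite lee_fin.
have Sfin : S \is a fin_num by rewrite ge0_fin_numE // (le_lt_trans sC) ?ltry.
apply/cvgrPdist_le => e e0.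
have [_ [X [finX _]] <-] := ub_ereal_sup_adherent e0 Sfin.
rewrite fsbig_finite//= sumEFin -/S => SX.
have {}SX : fine S - e < \sum_(i <- fset_set X) f i.
  by rewrite -lte_fin EFinB fineK.
exists (fset_set X) => //= F XF.
have FS : \sum_(i <- F) f i <= fine S.
  by rewrite -lee_fin fineK //; exact: sum_le_esum.
have XF' := le_sum_fset XF f0.
by rewrite ger0_norm; lra.
Qed.

(** [rsum] is the difference of the sums of the positive and negative parts,
    both of which converge. *)
Lemma abs_has_sum f (C : R) : (forall F, \sum_(i <- F) `|f i| <= C) ->
  has_sum f (rsum f).
Proof.
move=> fC; pose p g i : R := Num.max (g i) 0.
have pC g : (forall i, `|g i| = `|f i|) ->
    has_sum (p g) (fine (\esum_(i in [set: I]) (p g i)%:E)).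
  move=> gf; apply: (@nonneg_has_sum _ C) => [i|F]; first by rewrite le_max lexx orbT.
  apply: le_trans (fC F); apply: ler_sum => i _.
  by rewrite ge_max -gf ler_norm normr_ge0.
apply: eq_has_sum (has_sumB (pC f _) (pC (fun i => - f i) _)) => // i;
  last by rewrite normrN.
by rewrite /p !maxEle; do 2 case: ifP; lra.
Qed.

End unordered_sums.
Arguments has_sumZ {R I} c {f s}.
Arguments has_sum_fset {R I} F f.

(** * The real Euclidean structure of C^d *)
Section real_inner_product.
Set Implicit Arguments.
Unset Strict Implicit.
Local Open Scope complex_scope.
Context {R : realType} {d : nat}.
Implicit Types (x y z : 'cV[R[i]]_d) (r : R).

Definition ip x y : R := complex.Re (hermitian_dot x y).
Definition sq x : R := ip x x.

Lemma Re_sum (K : Type) (s : seq K) (P : pred K) (F : K -> R[i]) :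
  complex.Re (\sum_(k <- s | P k) F k) = \sum_(k <- s | P k) complex.Re (F k).
Proof. exact: (big_morph (@complex.Re R) (fun a b => raddfD (@complex.Re R) a b) erefl). Qed.

Lemma Im_sum (K : Type) (s : seq K) (P : pred K) (F : K -> R[i]) :
  complex.Im (\sum_(k <- s | P k) F k) = \sum_(k <- s | P k) complex.Im (F k).
Proof. by apply: (big_morph (@complex.Im R)) => // -[? ?] [? ?]. Qed.

Lemma ReM (a b : R[i]) : complex.Re (a * b) =
  complex.Re a * complex.Re b - complex.Im a * complex.Im b.
Proof. by case: a b => ? ? [? ?]. Qed.

Lemma ImM (a b : R[i]) : complex.Im (a * b) =
  complex.Re a * complex.Im b + complex.Im a * complex.Re b.
Proof. by case: a b => ? ? [? ?]. Qed.

Lemma hermitian_dotE x y :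
  hermitian_dot x y = \sum_(i < d) conjc (x i 0) * y i 0.
Proof. by rewrite /hermitian_dot mxE; apply: eq_bigr => i _; rewrite !mxE. Qed.

Lemma ipE x y : ip x y = \sum_(i < d)
  (complex.Re (x i 0) * complex.Re (y i 0) + complex.Im (x i 0) * complex.Im (y i 0)).
Proof.
rewrite /ip hermitian_dotE Re_sum; apply: eq_bigr => i _.
by rewrite ReM; case: (x i 0) => a b /=; rewrite mulNr opprK.
Qed.

Lemma ipC x y : ip x y = ip y x.
Proof. by rewrite !ipE; apply: eq_bigr => i _; ring. Qed.

Lemma ipDr x y z : ip x (y + z) = ip x y + ip x z.
Proof.
rewrite !ipE -big_split; apply: eq_bigr => i _ /=; rewrite !mxE.
by case: (y i 0) (z i 0) => ? ? [? ?] /=; ring.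
Qed.

Lemma ipZr x r y : ip x (r%:C *: y) = r * ip x y.
Proof.
rewrite !ipE mulr_sumr; apply: eq_bigr => i _ /=; rewrite !mxE ReM ImM /=.
by ring.
Qed.

Lemma ipDl x y z : ip (x + y) z = ip x z + ip y z.
Proof. by rewrite !(ipC _ z) ipDr. Qed.

Lemma ipZl x r y : ip (r%:C *: x) y = r * ip x y.
Proof. by rewrite !(ipC _ y) ipZr. Qed.

Lemma ipNr x y : ip x (- y) = - ip x y.
Proof. by rewrite -mulN1r -ipZr rmorphN1 scaleN1r. Qed.

Lemma ipNl x y : ip (- x) y = - ip x y.
Proof. by rewrite ipC ipNr ipC. Qed.

Lemma ipBr x y z : ip x (y - z) = ip x y - ip x z.
Proof. by rewrite ipDr ipNr. Qed.

Lemma ip0r x : ip x 0 = 0.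
Proof. by rewrite -(subrr 0) ipBr subrr. Qed.

Lemma ip_sumr (K : Type) (s : seq K) (P : pred K) x (y : K -> 'cV_d) :
  ip x (\sum_(k <- s | P k) y k) = \sum_(k <- s | P k) ip x (y k).
Proof. by apply: (big_morph (ip x)) => [? ?|]; [exact: ipDr|exact: ip0r]. Qed.

Lemma Im_hermitian_dot x y : complex.Im (hermitian_dot x y) = ip x (- 'i *: y).
Proof.
rewrite /ip !hermitian_dotE Im_sum Re_sum; apply: eq_bigr => i _.
by rewrite !mxE !ReM !ImM /=; case: (x i 0) (y i 0) => ? ? [? ?] /=; ring.
Qed.

Lemma normc_sqr (c : R[i]) :
  Normc.normc c ^+ 2 = complex.Re c ^+ 2 + complex.Im c ^+ 2.
Proof. by case: c => a b /=; rewrite sqr_sqrtr // addr_ge0 ?sqr_ge0. Qed.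

Lemma sqE x : sq x = \sum_(i < d) Normc.normc (x i 0) ^+ 2.
Proof. by rewrite /sq ipE; apply: eq_bigr => i _; rewrite normc_sqr. Qed.

Lemma sq_ge0 x : 0 <= sq x.
Proof. by rewrite sqE sumr_ge0 // => i _; exact: sqr_ge0. Qed.

Lemma sq0 : sq (0 : 'cV_d) = 0. Proof. exact: ip0r. Qed.

Lemma sq_eq0 x : sq x = 0 -> x = 0.
Proof.
rewrite sqE => /eqP; rewrite psumr_eq0; last by move=> i _; exact: sqr_ge0.
move=> /allP x0; apply/matrixP => i j; rewrite ord1 !mxE.
have /eqP/eqP := x0 i (mem_index_enum i).
rewrite normc_sqr paddr_eq0 ?sqr_ge0 // !sqrf_eq0.
by case: (x i 0) => a b /= /andP[/eqP -> /eqP ->].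
Qed.

Lemma sqZ (c : R[i]) x : sq (c *: x) = Normc.normc c ^+ 2 * sq x.
Proof.
rewrite !sqE mulr_sumr; apply: eq_bigr => i _.
by rewrite mxE !normc_sqr ReM ImM; ring.
Qed.

Lemma sqZB r x y : sq (r%:C *: x - y) = r ^+ 2 * sq x - 2 * r * ip x y + sq y.
Proof.
by rewrite /sq ipBr ipDl !ipZr ipDl !ipNl !ipZl -!(ipC x); ring.
Qed.

Lemma sqD_le x y : sq (x + y) <= 2 * sq x + 2 * sq y.
Proof.
have := sq_ge0 (1%:C *: x - y); rewrite sqZB.
by rewrite /sq ipDr !ipDl -(ipC x); lra.
Qed.

(** Expand [0 <= t^-1 |t x - y|^2], and once more with [- y] for [y]. *)
Lemma young (t : R) x y : 0 < t -> `|ip x y| <= (t * sq x + t^-1 * sq y) / 2.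
Proof.
move=> t0; have H z : ip x z <= (t * sq x + t^-1 * sq z) / 2.
  have : 0 <= t^-1 * sq (t%:C *: x - z) by rewrite mulr_ge0 ?sq_ge0 // invr_ge0 ltW.
  rewrite sqZB (_ : t^-1 * _ = t * sq x + t^-1 * sq z - 2 * ip x z).
    by rewrite subr_ge0 ler_pdivlMr // mulrC.
  by field; rewrite gt_eqF.
have := H (- y); rewrite ipNr (_ : sq (- y) = sq y); last by rewrite /sq ipNl ipNr opprK.
by rewrite ler_norml H => ?; rewrite andbT; lra.
Qed.

(** The real part of the Hermitian product already separates points, so vector
    identities may be tested against every [e]. *)
Lemma ip_inj (a b : 'cV[R[i]]_d) : (forall e, ip e a = ip e b) -> a = b.
Proof.
move=> ab; apply/eqP; rewrite -subr_eq0; apply/eqP; apply: sq_eq0.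
by rewrite /sq ipBr ab subrr.
Qed.

Lemma ip_conjZ (c : R[i]) e (a : 'cV[R[i]]_d) : ip e (c *: a) = ip (conjc c *: e) a.
Proof.
rewrite !ipE; apply: eq_bigr => i _; rewrite !mxE !ReM !ImM.
by case: c => ? ? /=; ring.
Qed.

End real_inner_product.

(** * Square-summable sequences *)
Section square_summable.
Set Implicit Arguments.
Unset Strict Implicit.
Local Open Scope complex_scope.
Context {R : realType} {d : nat}.
Local Notation I := 'rV[int]_d.
Local Notation Seq := (I -> 'cV[R[i]]_d).
Implicit Types (u v w : Seq) (F G : {fset I}) (C : R).

Definition l2sq u : R := fine (\esum_(n in [set: I]) (sq (u n))%:E).

Lemma l2_normE u :
  l2_norm u = sqrte (\esum_(n in [set: I]) (sq (u n))%:E).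
Proof.
rewrite /l2_norm poweR12_sqrt; last first.
  by apply: esum_ge0 => n _; rewrite lee_fin sumr_ge0 // => i _; exact: sqr_ge0.
by congr sqrte; apply: eq_esum => n _; rewrite sqE.
Qed.

Lemma esum_sq_ge0 u : (0 <= \esum_(n in [set: I]) (sq (u n))%:E)%E.
Proof. by apply: esum_ge0 => n _; rewrite lee_fin sq_ge0. Qed.

Lemma l2_norm_le u (c : R) : 0 <= c ->
  (forall F, \sum_(n <- F) sq (u n) <= c ^+ 2) -> (l2_norm u <= c%:E)%E.
Proof.
move=> c0 /esum_le; rewrite l2_normE => uc.
have := esum_sq_ge0 u; move: uc; set S := esum _ _.
case: S => [s| |] //=; rewrite !lee_fin => sc s0.
by rewrite -(ger0_norm c0) -sqrtr_sqr ler_wsqrtr.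
Qed.

Lemma l2_le u C : (forall F, \sum_(n <- F) sq (u n) <= C) -> l2 u.
Proof.
move=> uC; rewrite /l2 /=; apply: le_lt_trans (ltry (Num.sqrt C)).
have C0 : 0 <= C by have := uC fset0; rewrite big_seq_fset0.
by apply: l2_norm_le; rewrite ?sqrtr_ge0 // => F; rewrite sqr_sqrtr.
Qed.

Lemma l2_esum u : l2 u -> \esum_(n in [set: I]) (sq (u n))%:E = (l2sq u)%:E.
Proof.
rewrite /l2 /= l2_normE /l2sq; have := esum_sq_ge0 u.
by case: (esum _ _).
Qed.

Lemma l2_ge u F : l2 u -> \sum_(n <- F) sq (u n) <= l2sq u.
Proof.
move=> lu; rewrite -lee_fin -(l2_esum lu).
by apply: (sum_le_esum (f := fun n => sq (u n))) => n; exact: sq_ge0.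
Qed.

Lemma l2_has_sum u : l2 u -> has_sum (fun n => sq (u n)) (l2sq u).
Proof.
move=> lu; apply: nonneg_has_sum => [n|F]; first exact: sq_ge0.
exact: l2_ge lu.
Qed.

Lemma l2sq_le u C : l2 u -> (forall F, \sum_(n <- F) sq (u n) <= C) ->
  l2sq u <= C.
Proof. by move=> /l2_has_sum /has_sum_le; apply. Qed.

Lemma l2sq_ge0 u : 0 <= l2sq u.
Proof. by rewrite fine_ge0 // esum_sq_ge0. Qed.

Lemma l2_norm_l2sq u : l2 u -> l2_norm u = (Num.sqrt (l2sq u))%:E.
Proof. by move=> lu; rewrite l2_normE l2_esum. Qed.

Lemma sq_le_l2sq u n : l2 u -> sq (u n) <= l2sq u.
Proof. by move=> /(l2_ge [fset n]%fset); rewrite big_seq_fset1. Qed.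

Lemma l2sq_eq0 u : l2 u -> l2sq u <= 0 -> u = 0.
Proof.
move=> lu u0; apply/funext => n; apply: sq_eq0; apply/eqP.
by rewrite eq_le sq_ge0 (le_trans (sq_le_l2sq n lu)).
Qed.

Lemma l2D u v : l2 u -> l2 v -> l2 (u + v).
Proof.
move=> lu lv; apply: (@l2_le _ (2 * l2sq u + 2 * l2sq v)) => F.
apply: (@le_trans _ _ (\sum_(n <- F) (2 * sq (u n) + 2 * sq (v n)))).
  by apply: ler_sum => n _; exact: sqD_le.
rewrite big_split -!mulr_sumr /=.
by have := l2_ge F lu; have := l2_ge F lv; lra.
Qed.

Lemma l2Z (c : R[i]) u : l2 u -> l2 (c *: u).
Proof.
move=> lu; apply: (@l2_le _ (Normc.normc c ^+ 2 * l2sq u)) => F.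
rewrite (eq_bigr (fun n => Normc.normc c ^+ 2 * sq (u n))) => [|n _]; last exact: sqZ.
by rewrite -mulr_sumr ler_wpM2l ?sqr_ge0 // l2_ge.
Qed.

Lemma l20 : l2 (0 : Seq).
Proof. by apply: (@l2_le _ 0) => F; rewrite big1 // => n _; exact: sq0. Qed.

Lemma l2N u : l2 u -> l2 (- u).
Proof. by move=> lu; rewrite -scaleN1r; exact: l2Z. Qed.

Lemma l2B u v : l2 u -> l2 v -> l2 (u - v).
Proof. by move=> lu lv; apply: l2D => //; exact: l2N. Qed.

Definition dot u v : R := rsum (fun n => ip (u n) (v n)).

Lemma sum_abs_ip_le (t : R) u v F : 0 < t ->
  \sum_(n <- F) `|ip (u n) (v n)| <=
  (t * \sum_(n <- F) sq (u n) + t^-1 * \sum_(n <- F) sq (v n)) / 2.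
Proof.
move=> t0; rewrite !mulr_sumr -big_split mulr_suml.
by apply: ler_sum => n _; exact: young.
Qed.

Lemma dot_has_sum u v : l2 u -> l2 v ->
  has_sum (fun n => ip (u n) (v n)) (dot u v).
Proof.
move=> lu lv; apply: (@abs_has_sum _ _ _ ((l2sq u + l2sq v) / 2)) => F.
apply: le_trans (sum_abs_ip_le u v F ltr01) _.
by have := l2_ge F lu; have := l2_ge F lv; rewrite invr1 !mul1r; lra.
Qed.

Lemma dotC u v : dot u v = dot v u.
Proof. by congr rsum; apply/funext => n; exact: ipC. Qed.

Lemma dotZr u (r : R) v : l2 u -> l2 v -> dot u (r%:C *: v) = r * dot u v.
Proof.
move=> lu lv; apply: has_sum_unique (dot_has_sum lu (l2Z _ lv)) _.
by apply: eq_has_sum (has_sumZ r (dot_has_sum lu lv)) => n; rewrite -ipZr.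
Qed.

Lemma l2sqZB (r : R) u v : l2 u -> l2 v ->
  l2sq (r%:C *: u - v) = r ^+ 2 * l2sq u - 2 * r * dot u v + l2sq v.
Proof.
move=> lu lv; apply: has_sum_unique (l2_has_sum (l2B (l2Z _ lu) lv)) _.
apply: eq_has_sum (has_sumD (has_sumB (has_sumZ (r ^+ 2) (l2_has_sum lu))
  (has_sumZ (2 * r) (dot_has_sum lu lv))) (l2_has_sum lv)) => n.
by rewrite -sqZB.
Qed.

Lemma dot_le (t : R) u v : 0 < t -> l2 u -> l2 v ->
  dot u v <= (t * l2sq u + t^-1 * l2sq v) / 2.
Proof.
move=> t0 lu lv; apply: has_sum_le (dot_has_sum lu lv) _ => F.
apply: le_trans (ler_sum _ (fun n _ => ler_norm _)) _.
apply: le_trans (sum_abs_ip_le u v F t0) _.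
rewrite ler_pM2r // lerD // ler_pM2l ?invr_gt0 //; exact: l2_ge.
Qed.

Lemma l2sqB_le u v : l2 u -> l2 v -> l2sq (u - v) <= 2 * (l2sq u + l2sq v).
Proof.
move=> lu lv; have := l2sqZB 1 lu lv; rewrite scale1r => ->.
have := l2sqZB (-1) lu lv; have := l2sq_ge0 ((-1)%:C *: u - v).
by lra.
Qed.

Definition l2_linear (T : Seq -> Seq) : Prop :=
  forall (c : R[i]) u v, l2 u -> l2 v -> T (c *: u + v) = c *: T u + T v.

Lemma l2_linearB (T : Seq -> Seq) u v :
  l2_linear T -> l2 u -> l2 v -> T (u - v) = T u - T v.
Proof.
move=> Tlin lu lv; rewrite -[u - v]addrC -scaleN1r Tlin //.
by rewrite scaleN1r addrC.
Qed.

Lemma l2_linearZ (T : Seq -> Seq) (c : R[i]) u :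
  l2_linear T -> l2 u -> T (c *: u) = c *: T u.
Proof.
move=> Tlin lu; have T0 : T 0 = 0.
  by rewrite -(subrr (0 : Seq)) (l2_linearB Tlin) ?subrr //; exact: l20.
by rewrite -[c *: u]addr0 Tlin ?T0 ?addr0 //; exact: l20.
Qed.

End square_summable.

(** * Hermitian kernels with bounded finite sections *)
Section hermitian_kernel.
Set Implicit Arguments.
Unset Strict Implicit.
Local Open Scope complex_scope.
Context {R : realType} {d : nat}.
Local Notation I := 'rV[int]_d.
Local Notation Seq := (I -> 'cV[R[i]]_d).
Implicit Types (u v x y : Seq) (e : 'cV[R[i]]_d) (F G : {fset I}).
Variables (M : I -> I -> 'M[R[i]]_d) (alpha beta : R).

Definition hermitian_kernel := forall n m (x y : 'cV[R[i]]_d),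
  ip x (M n m *m y) = ip y (M m n *m x).

Definition form F x y : R :=
  \sum_(n <- F) \sum_(m <- F) ip (x n) (M n m *m y m).

Definition form_bounds := forall F x,
  alpha * \sum_(n <- F) sq (x n) <= form F x x <= beta * \sum_(n <- F) sq (x n).

(** Rows are tested against vectors [e], so that every series involved is
    real. *)
Definition represents (T : Seq -> Seq) := forall u n e, l2 u ->
  has_sum (fun m => ip e (M n m *m u m)) (ip e (T u n)).

Hypothesis Mherm : hermitian_kernel.
Hypothesis Mbounds : form_bounds.
Hypothesis alpha0 : 0 < alpha.
Hypothesis alpha_beta : alpha <= beta.

Let beta0 : 0 < beta. Proof. exact: lt_le_trans alpha_beta. Qed.

Lemma formC F x y : form F x y = form F y x.
Proof.
rewrite /form exchange_big /=; apply: eq_bigr => m _; apply: eq_bigr => n _.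
exact: Mherm.
Qed.

Lemma formZB F (r : R) x y : form F (r%:C *: y - x) (r%:C *: y - x) =
  r ^+ 2 * form F y y - 2 * r * form F x y + form F x x.
Proof.
have -> : 2 * r * form F x y = r * form F x y + r * form F y x.
  by rewrite (@formC F y x); ring.
rewrite opprD addrA /form !mulr_sumr -!sumrN -!big_split; apply: eq_bigr => n _ /=.
rewrite !mulr_sumr -!sumrN -!big_split; apply: eq_bigr => m _ /=.
have -> : (r%:C *: y - x) n = r%:C *: y n - x n by [].
have -> : (r%:C *: y - x) m = r%:C *: y m - x m by [].
rewrite mulmxBr -scalemxAr ipBr ipDl !ipZr !ipDl !ipNl !ipZl.
by ring.
Qed.

(** Nonnegativity of the form at [beta y - x] turns the two-sided bound on the
    diagonal of the form into a bound on its off-diagonal values. *)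
Lemma form_young F G x y : (F `<=` G)%fset ->
  2 * (\sum_(n <- F) \sum_(m <- G) ip (x n) (M n m *m y m)) <=
  \sum_(n <- F) sq (x n) + beta ^+ 2 * \sum_(m <- G) sq (y m).
Proof.
move=> FG; pose x' n := if n \in F then x n else 0.
have Ex : \sum_(n <- F) \sum_(m <- G) ip (x n) (M n m *m y m) = form G x' y.
  rewrite /form -(sum_fset_indic _ FG); apply: eq_bigr => n _.
  rewrite /x'; case: ifP => // _; rewrite big1 // => m _.
  by rewrite ipC ip0r.
have Sx : \sum_(n <- G) sq (x' n) = \sum_(n <- F) sq (x n).
  rewrite -(sum_fset_indic _ FG); apply: eq_bigr => n _.
  by rewrite /x'; case: ifP => // _; rewrite sq0.
have /andP[pos _] := Mbounds G (beta%:C *: y - x').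
have /andP[_ uy] := Mbounds G y; have /andP[_ ux] := Mbounds G x'.
rewrite formZB in pos; rewrite Ex -Sx -(ler_pM2l beta0).
have : 0 <= alpha * \sum_(n <- G) sq ((beta%:C *: y - x') n).
  by apply: mulr_ge0; [exact: ltW|apply: sumr_ge0 => n _; exact: sq_ge0].
move/le_trans => /(_ _ pos).
have := ler_wpM2l (sqr_ge0 beta) uy.
set A := form G y y in uy *; set B := form G x' y; set S := form G x' x' in ux *.
set X := \sum_(n <- G) sq (x' n) in ux *; set Y := \sum_(n <- G) sq (y n) in uy *.
move=> h1 h2; have : beta * (X + beta ^+ 2 * Y) = beta * X + beta ^+ 2 * (beta * Y) by ring.
by move=> ->; nra.
Qed.

(** [form_young] for [F] a single frequency; its right side is independent of
    how the [y m] are signed. *)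
Lemma kernel_row_le n e y F : l2 y ->
  \sum_(m <- F) `|ip e (M n m *m y m)| <= (sq e + beta ^+ 2 * l2sq y) / 2.
Proof.
move=> ly; pose G := (n |` F)%fset.
have FG : (F `<=` G)%fset by exact: fsubsetU1.
have nG : ([fset n] `<=` G)%fset by rewrite fsub1set fset1U1.
apply: le_trans (le_sum_fset FG _) _ => [m|]; first exact: normr_ge0.
pose y' m := (Num.sg (ip e (M n m *m y m)))%:C *: y m.
have := form_young (fun=> e) y' nG; rewrite !big_seq_fset1.
rewrite (eq_bigr (fun m => `|ip e (M n m *m y m)|)) => [|m _]; last first.
  by rewrite -scalemxAr ipZr normrEsg.
(* The signs in [y'] turn the row sum into a sum of absolute values. *)
have : \sum_(m <- G) sq (y' m) <= l2sq y.
  apply: le_trans (l2_ge G ly); apply: ler_sum => m _.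
  rewrite sqZ normc_sqr /= expr0n addr0 sqr_sg.
  by case: (_ != 0); rewrite ?mul1r ?mul0r ?sq_ge0.
move=> /(ler_wpM2l (sqr_ge0 beta)) h1 h2.
by rewrite ler_pdivlMr // mulrC; apply: le_trans h2 _; rewrite lerD2l.
Qed.

Variable T : Seq -> Seq.
Hypothesis TM : represents T.

Lemma op_linear : l2_linear T.
Proof.
move=> c u v lu lv; apply/funext => n; apply: ip_inj => e.
apply: has_sum_unique (@TM _ n e (l2D (l2Z c lu) lv)) _.
rewrite ipDr ip_conjZ; apply: eq_has_sum (has_sumD (@TM _ n _ lu) (@TM _ n _ lv)) => m.
by rewrite -ip_conjZ -ipDr scalemxAr -mulmxDr.
Qed.

(** Apply [form_young] with [x := T u] on [F] and let [G] grow: the left side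
    tends to twice the sum being bounded, half of which is absorbed. *)
Lemma op_l2_le u F : l2 u -> \sum_(n <- F) sq (T u n) <= beta ^+ 2 * l2sq u.
Proof.
move=> lu; set s := \sum_(n <- F) _.
have : has_sum (fun m => \sum_(n <- F) ip (T u n) (M n m *m u m)) s.
  by apply: has_sum_sum => n; exact: TM.
move=> /cvgr_to_le => /(_ ((s + beta ^+ 2 * l2sq u) / 2)).
suff H : \forall G \near @totally I,
    \sum_(m <- (G : {fset I})) \sum_(n <- F) ip (T u n) (M n m *m u m)
    <= (s + beta ^+ 2 * l2sq u) / 2 by move=> /(_ H); lra.
exists F => //= G FG; rewrite exchange_big ler_pdivlMr // mulrC.
apply: le_trans (form_young (T u) u FG) _.
by rewrite lerD2l ler_wpM2l ?sqr_ge0 // l2_ge.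
Qed.

Lemma op_l2 u : l2 u -> l2 (T u).
Proof. by move=> lu; apply: l2_le => F; exact: op_l2_le. Qed.

Lemma op_l2sq_le u : l2 u -> l2sq (T u) <= beta ^+ 2 * l2sq u.
Proof. by move=> lu; apply: l2sq_le => [|F]; [exact: op_l2|exact: op_l2_le]. Qed.

(** Replacing [T v] on [F] by the partial row sums costs the pairing of [u]
    with [T] applied to the tail of [v] outside [F]; by boundedness of [T] this
    is small once the tail is. *)
Lemma form_cvg u v : l2 u -> l2 v ->
  (fun F => form F u v) @ totally --> dot u (T v).
Proof.
move=> lu lv.
pose tr F (v : Seq) := fun m => if m \in F then v m else 0.
have ltr F : l2 (v - tr F v) /\ l2sq (v - tr F v) = l2sq v - \sum_(n <- F) sq (v n).
  have H : has_sum (fun n => sq ((v - tr F v) n)) (l2sq v - \sum_(n <- F) sq (v n)).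
    apply: eq_has_sum (has_sumB (l2_has_sum lv) (has_sum_fset F (fun n => sq (v n)))) => n /=.
    rewrite (_ : (v - tr F v) n = v n - tr F v n) // /tr.
    by case: ifP => _; rewrite ?subrr ?subr0 ?sq0.
  have lt : l2 (v - tr F v).
    by apply: l2_le => G; apply: has_sum_ge H _ => n; exact: sq_ge0.
  by split=> //; apply: has_sum_unique (l2_has_sum lt) H.
have ltv F : l2 (tr F v).
  by have [/(l2B lv)] := ltr F; rewrite opprB addrC subrK.
pose D F := \sum_(n <- F) ip (u n) (T (v - tr F v) n).
have -> : (fun F => form F u v) =
    (fun F : {fset I} => \sum_(n <- F) ip (u n) (T v n)) \- D.
  apply/funext => F; rewrite /= /D -sumrB; apply: eq_bigr => n _.
  rewrite (l2_linearB op_linear) // (_ : (T v - T (tr F v)) n = T v n - T (tr F v) n) // ipBr subKr.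
  apply: has_sum_unique (has_sum_fset F _) _ => /=.
  apply: eq_has_sum (@TM _ n (u n) (ltv F)) => m; rewrite /tr.
  by case: ifP => // _; rewrite mulmx0 ip0r.
rewrite -[dot u (T v)]subr0; apply: cvgB.
  exact: (dot_has_sum lu (op_l2 lv)).
apply/cvgr0Pnorm_le => e e0; pose t := e / (l2sq u + 1).
(* This [t] makes the [u]-half of Young's inequality at most [e]. *)
have u1 : 0 < l2sq u + 1 by rewrite ltr_wpDl ?l2sq_ge0.
have t0 : 0 < t by rewrite divr_gt0.
have d0 : 0 < e * t / beta ^+ 2 by rewrite divr_gt0 ?exprn_gt0 // mulr_gt0.
have := l2_has_sum lv => /cvgrPdist_le /(_ _ d0); apply: filterS => F Fv.
have [l1 E1] := ltr F.
apply: le_trans (ler_norm_sum _ _ _) _.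
apply: le_trans (sum_abs_ip_le _ _ F t0) _.
have b1 : t * \sum_(n <- F) sq (u n) <= e.
  rewrite /t mulrAC ler_pdivrMr // ler_pM2l //.
  by apply: le_trans (l2_ge F lu) _; rewrite lerDl.
have b2 : t^-1 * \sum_(n <- F) sq (T (v - tr F v) n) <= e.
  rewrite mulrC ler_pdivrMr //.
  apply: le_trans (op_l2_le F l1) _; rewrite E1 mulrC -ler_pdivlMr ?exprn_gt0 //.
  by apply: le_trans Fv; exact: ler_norm.
lra.
Qed.

Lemma op_symmetric u v : l2 u -> l2 v -> dot (T u) v = dot u (T v).
Proof.
move=> lu lv; rewrite dotC; have := form_cvg lv lu.
rewrite (_ : (fun F => _) = fun F => form F u v).
  by move=> h; apply: cvg_unique h (form_cvg lu lv).
by apply/funext => F; exact: formC.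
Qed.

Lemma op_coercive u : l2 u -> alpha * l2sq u <= dot u (T u).
Proof.
move=> lu; rewrite -subr_ge0.
have H : (fun F => form F u u - alpha * \sum_(n <- F) sq (u n)) @ totally -->
    dot u (T u) - alpha * l2sq u.
  by apply: cvgB; [exact: form_cvg|apply: cvgMr; exact: l2_has_sum].
apply: (cvgr_to_ge H); exists fset0 => //= F _; rewrite subr_ge0.
by have /andP[] := Mbounds F u.
Qed.

End hermitian_kernel.

(** * Bounded coercive operators are invertible *)
Section lax_milgram.
Set Implicit Arguments.
Unset Strict Implicit.
Local Open Scope complex_scope.
Context {R : realType} {d : nat}.
Local Notation I := 'rV[int]_d.
Local Notation Seq := (I -> 'cV[R[i]]_d).
Implicit Types (u v f : Seq).

Lemma le_geometric_eq0 (a q C : R) : 0 <= q < 1 ->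
  (forall k, a <= C * q ^+ k) -> a <= 0.
Proof.
move=> /andP[q0 q1] aC.
have qk : (fun k => C * q ^+ k) @ \oo --> C * 0.
  by apply: cvgMr; apply: cvg_expr; rewrite ger0_norm.
by rewrite -(mulr0 C); apply: (cvgr_to_ge qk); exact: nearW.
Qed.

Lemma cvg_geometric (a : R^nat) (q C : R) : 0 <= q < 1 ->
  (forall k m, (k <= m)%N -> (a m - a k) ^+ 2 <= C * q ^+ k) -> cvgn a.
Proof.
move=> /andP[q0 q1] aC; apply/cauchy_cvgP/cauchy_exP => e e0.
have qk : (fun k => C * q ^+ k) @ \oo --> C * 0.
  by apply: cvgMr; apply: cvg_expr; rewrite ger0_norm.
rewrite mulr0 in qk; have e2 : 0 < e ^+ 2 by rewrite exprn_gt0.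
have [k _ /(_ k (leqnn k)) Hk] := cvgr_lt 0 qk _ e2.
exists (a k); exists k => //= m km; rewrite /ball /= distrC.
rewrite -(ltr_pXn2r (n := 2)) ?nnegrE ?(ltW e0) // real_normK ?num_real //.
by apply: le_lt_trans (aC _ _ km) Hk.
Qed.

Lemma cvg_sumR (K : Type) (r : seq K) (a : K -> R^nat) (l : K -> R) :
  (forall k, a k @ \oo --> l k) ->
  (fun m => \sum_(k <- r) a k m) @ \oo --> \sum_(k <- r) l k.
Proof. by move=> al; apply: cvg_big => //; exact: add_continuous. Qed.

(** The limit is characterised by distances to fixed vectors, which is the form
    in which finite sums over frequencies pass to the limit. *)
Lemma sq_lim (z : nat -> 'cV[R[i]]_d) (q C : R) : 0 <= q < 1 ->
  (forall k m, (k <= m)%N -> sq (z m - z k) <= C * q ^+ k) ->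
  exists w, forall c, (fun m => sq (z m - c)) @ \oo --> sq (w - c).
Proof.
move=> q01 zC.
have coord (p : R[i] -> R) : (forall a b, p (a - b) = p a - p b) ->
    (forall a, p a ^+ 2 <= Normc.normc a ^+ 2) ->
    forall i, cvgn (fun m => p (z m i 0)).
  move=> pB pn i; apply: (cvg_geometric q01) => k m /zC; apply: le_trans.
  rewrite sqE (bigD1 i) //= -pB; apply: ler_wpDr.
    by apply: sumr_ge0 => j _; exact: sqr_ge0.
  by apply: le_trans (pn _) _; rewrite !mxE.
have cR i : cvgn (fun m => complex.Re (z m i 0)).
  by apply: coord => [[? ?] [? ?]|a] //; rewrite normc_sqr lerDl sqr_ge0.
have cI i : cvgn (fun m => complex.Im (z m i 0)).
  by apply: coord => [[? ?] [? ?]|a] //; rewrite normc_sqr lerDr sqr_ge0.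
exists (\col_i (lim (complex.Re (z m i 0) @[m --> \oo]) +i*
                lim (complex.Im (z m i 0) @[m --> \oo]))) => c.
have E y : sq (y - c) = \sum_(i < d) ((complex.Re (y i 0) - complex.Re (c i 0)) ^+ 2 +
    (complex.Im (y i 0) - complex.Im (c i 0)) ^+ 2).
  rewrite sqE; apply: eq_bigr => i _; rewrite normc_sqr !mxE.
  by case: (y i 0) (c i 0) => ? ? [? ?].
rewrite E (_ : (fun m => _) = fun m => \sum_(i < d)
  ((complex.Re (z m i 0) - complex.Re (c i 0)) ^+ 2 +
   (complex.Im (z m i 0) - complex.Im (c i 0)) ^+ 2)); last exact/funext.
apply: cvg_sumR => i; rewrite !mxE /=.
have sqB (p : R[i] -> R) : cvgn (fun m => p (z m i 0)) ->
    (fun m => (p (z m i 0) - p (c i 0)) ^+ 2) @ \oo -->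
    (lim (p (z m i 0) @[m --> \oo]) - p (c i 0)) ^+ 2.
  move=> pz; have h : (fun m => p (z m i 0) - p (c i 0)) @ \oo -->
      lim (p (z m i 0) @[m --> \oo]) - p (c i 0).
    exact: (cvgB pz (cvg_cst _)).
  rewrite expr2 (_ : (fun m => _ ^+ 2) =
    (fun m => p (z m i 0) - p (c i 0)) \* (fun m => p (z m i 0) - p (c i 0))).
    exact: cvgM.
  by apply/funext => m /=; rewrite expr2.
exact: cvgD (sqB _ (cR i)) (sqB _ (cI i)).
Qed.

(** Limits are taken frequency by frequency; the distance bounds hold on every
    finite set of frequencies and pass to the limit there. *)
Lemma l2_complete (x : nat -> Seq) (q C : R) : 0 <= q < 1 ->
  (forall k, l2 (x k)) ->
  (forall k m, (k <= m)%N -> l2sq (x m - x k) <= C * q ^+ k) ->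
  exists2 y, l2 y & forall k, l2sq (y - x k) <= C * q ^+ k.
Proof.
move=> q01 lx xC.
have pt n : exists w, forall c, (fun m => sq (x m n - c)) @ \oo --> sq (w - c).
  apply: (sq_lim q01) => k m km; apply: le_trans (xC _ _ km).
  exact: (sq_le_l2sq n (l2B (lx m) (lx k))).
have [y yx] := choice pt.
have yk k (F : {fset I}) : \sum_(n <- F) sq ((y - x k) n) <= C * q ^+ k.
  have H : (fun m => \sum_(n <- F) sq (x m n - x k n)) @ \oo -->
      \sum_(n <- F) sq (y n - x k n).
    by apply: cvg_sumR => n; exact: yx.
  apply: (cvgr_to_le H); exists k => //= m km; apply: le_trans (xC _ _ km).
  exact: (l2_ge F (l2B (lx m) (lx k))).
have lk k : l2 (y - x k) by apply: l2_le => F; exact: yk.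
exists y => [|k]; last by apply: l2sq_le.
by rewrite -(subrK (x 0%N) y); exact: l2D.
Qed.

Variables (T : Seq -> Seq) (alpha beta : R).
Hypothesis alpha0 : 0 < alpha.
Hypothesis alpha_beta : alpha <= beta.
Hypothesis Tl2 : forall u, l2 u -> l2 (T u).
Hypothesis Tlin : l2_linear T.
Hypothesis Tbound : forall u, l2 u -> l2sq (T u) <= beta ^+ 2 * l2sq u.
Hypothesis Tcoer : forall u, l2 u -> alpha * l2sq u <= dot u (T u).

Let beta0 : 0 < beta. Proof. exact: lt_le_trans alpha_beta. Qed.

(** Coercivity and Young's inequality at [t = alpha]:
    [alpha |u|^2 <= <u, T u> <= (alpha |u|^2 + alpha^-1 |T u|^2) / 2]. *)
Lemma coercive_bounded_below u : l2 u -> alpha ^+ 2 * l2sq u <= l2sq (T u).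
Proof.
move=> lu; have := dot_le alpha0 lu (Tl2 lu); have := Tcoer lu.
move=> /le_trans h /h; rewrite -(ler_pM2l alpha0) => {}h.
have E : alpha * ((alpha * l2sq u + alpha^-1 * l2sq (T u)) / 2) =
  (alpha ^+ 2 * l2sq u + l2sq (T u)) / 2 by field; rewrite gt_eqF.
have E2 : alpha * (alpha * l2sq u) = alpha ^+ 2 * l2sq u by ring.
by rewrite E E2 in h; lra.
Qed.

Lemma coercive_injective u v : l2 u -> l2 v -> T u = T v -> u = v.
Proof.
move=> lu lv uv; apply/eqP; rewrite -subr_eq0; apply/eqP.
apply: l2sq_eq0 (l2B lu lv) _; rewrite -(pmulr_rle0 _ (exprn_gt0 2 alpha0)).
apply: le_trans (coercive_bounded_below (l2B lu lv)) _.
by rewrite (l2_linearB Tlin) // uv subrr /l2sq esum1 // => n _; rewrite sq0.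
Qed.

(** Iterate [x := x + t (f - T x)].  The residual [r = f - T x] becomes
    [r - t T r], whose squared norm is at most
    [(1 - 2 t alpha + t^2 beta^2) |r|^2]; the choice [t = alpha / beta^2]
    minimises this factor, to [q = 1 - alpha^2 / beta^2].  Since [T] is bounded
    below, geometrically small residuals make the iterates Cauchy. *)
Lemma coercive_surjective f : l2 f -> exists2 u, l2 u & T u = f.
Proof.
move=> lf; pose t := alpha / beta ^+ 2; pose q := 1 - alpha ^+ 2 / beta ^+ 2.
have q01 : 0 <= q < 1.
  have b2 : 0 < beta ^+ 2 by rewrite exprn_gt0.
  have a2 : 0 < alpha ^+ 2 by rewrite exprn_gt0.
  have ab : alpha ^+ 2 <= beta ^+ 2 by rewrite lerXn2r // nnegrE ltW.
  by rewrite /q subr_ge0 ler_pdivrMr // mul1r ab ltrBlDr ltrDl divr_gt0.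
pose x := fix x k := if k is k'.+1 then t%:C *: (f - T (x k')) + x k' else 0.
have lx k : l2 (x k).
  by elim: k => [|k IH] /=; [exact: l20|apply: l2D => //; apply: l2Z; apply: l2B => //; exact: Tl2].
pose r k := f - T (x k).
have lr k : l2 (r k) by apply: l2B => //; exact: Tl2.
have rS k : - r k.+1 = t%:C *: T (r k) - r k.
  by rewrite {1}/r [x _]/= (Tlin _ (lr k) (lx k)) opprB {3}/r opprB addrA.
have sqN u : l2 u -> l2sq (- u) = l2sq u.
  by move=> lu; congr fine; apply: eq_esum => n _; rewrite /sq ipNl ipNr opprK.
have rq k : l2sq (r k) <= l2sq f * q ^+ k.
  elim: k => [|k IH].
    rewrite expr0 mulr1 /r /= -(subrr (0 : Seq)) (l2_linearB Tlin) ?subrr ?subr0 //; exact: l20.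
  rewrite -sqN // rS l2sqZB //; last exact: Tl2.
  rewrite (exprS q) (mulrCA (l2sq f)); have q0 : 0 <= q by case/andP: q01.
  apply: le_trans _ (ler_wpM2l q0 IH).
  have h1 := Tcoer (lr k); have h2 := Tbound (lr k).
  rewrite dotC in h1.
  have t0 : 0 < t by rewrite divr_gt0 // exprn_gt0.
  have := ler_wpM2l (sqr_ge0 t) h2; have := ler_wpM2l (ltW t0) h1.
  have -> : q * l2sq (r k) = l2sq (r k) - 2 * (t * (alpha * l2sq (r k)))
       + t ^+ 2 * (beta ^+ 2 * l2sq (r k)).
    by rewrite /q /t; field; rewrite gt_eqF.
  lra.
have f0 : 0 <= l2sq f by exact: l2sq_ge0.
have xC k m : (k <= m)%N -> l2sq (x m - x k) <= (4 * l2sq f / alpha ^+ 2) * q ^+ k.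
  move=> km; rewrite mulrAC ler_pdivlMr ?exprn_gt0 // mulrC.
  apply: le_trans (coercive_bounded_below (l2B (lx m) (lx k))) _.
  rewrite (l2_linearB Tlin) //.
  have -> : T (x m) - T (x k) = r k - r m by rewrite /r opprB [RHS]addrC addrA subrK.
  apply: le_trans (l2sqB_le (lr k) (lr m)) _.
  have qkm : l2sq f * q ^+ m <= l2sq f * q ^+ k.
    by apply: ler_wpM2l => //; apply: ler_wiXn2l => //; case/andP: q01 => // _ /ltW.
  by have := rq k; have := rq m; lra.
have [y ly yx] := l2_complete q01 lx xC.
exists y => //; apply/eqP; rewrite -subr_eq0; apply/eqP.
have lTf : l2 (T y - f) by apply: l2B => //; exact: Tl2.
apply: l2sq_eq0 lTf _.
apply: (le_geometric_eq0 (C := 2 * (beta ^+ 2 * (4 * l2sq f / alpha ^+ 2) + l2sq f)) q01) => k.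
have -> : T y - f = T (y - x k) - r k.
  by rewrite (l2_linearB Tlin) // /r opprB addrA subrK.
apply: le_trans (l2sqB_le _ (lr k)) _; first by apply: Tl2; exact: l2B.
have := Tbound (l2B ly (lx k)); have := ler_wpM2l (sqr_ge0 beta) (yx k); have := rq k.
move=> h1 h2 h3; rewrite -mulrA ler_pM2l // mulrDl -mulrA.
by apply: lerD => //; apply: le_trans h3 _.
Qed.

End lax_milgram.

(** * Integrals of characters over the cube *)
Section exponential_integrals.
Set Implicit Arguments.
Unset Strict Implicit.
Context {R : realType}.

Lemma sinD2pi_int (phi : R) (k : int) : sin (phi + 2 * pi * k%:~R) = sin phi.
Proof.
have P (n : nat) (a : R) : sin (a + 2 * pi * n%:R) = sin a.
  rewrite -[RHS](periodicn (@sinD2pi R) n); congr sin.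
  by rewrite -[(pi *+ 2) *+ n]mulr_natr -(mulr_natr pi) (mulrC pi).
case: k => n; first by rewrite -[RHS](P n).
by rewrite NegzE mulrNz mulrN -[LHS](P n.+1) subrK.
Qed.

(** The constant [1] keeps the integrand nonnegative, as needed to pass from
    the uniform law to Lebesgue measure. *)
Lemma integral_1cos (phi : R) (k : int) : k != 0 ->
  (\int[uniform_prob (@ltr01 R)]_t (1 + cos (phi + 2 * pi * k%:~R * t))%:E = 1)%E.
Proof.
move=> k0; set w := 2 * pi * k%:~R.
have w0 : w != 0 by rewrite !mulf_neq0 ?intr_eq0 // gt_eqF // pi_gt0.
have clin : continuous (fun t : R => phi + w * t).
  move=> t; apply: cvgD; [exact: cvg_cst|exact: cvgMr].
have cc : continuous (fun t : R => 1 + cos (phi + w * t)).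
  move=> t; apply: cvgD; first exact: cvg_cst.
  by apply: continuous_comp; [exact: clin|exact: continuous_cos].
rewrite integral_uniform; last 2 first.
- apply/measurable_EFinP; exact: continuous_measurable_fun.
- by move=> t; rewrite lee_fin -lerBlDl sub0r; exact: cos_geN1.
rewrite subr0 invr1 mul1e.
pose F (t : R) := t + w^-1 * sin (phi + w * t).
have dF (t : R) : is_derive t 1 F (1 + cos (phi + w * t)).
  have dl := is_deriveD (is_derive_cst phi t 1) (is_deriveZ w (is_derive_id t 1)).
  have ds := is_deriveZ w^-1 (is_derive1_comp (is_derive_sin _) dl).
  apply: (is_derive_eq (is_deriveD (is_derive_id t 1) ds)).
  rewrite add0r /GRing.scale /= mulr1 (mulrC _ w) mulKf //.
have cF : continuous F.
  move=> t; apply: differentiable_continuous; apply/derivable1_diffP.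
  by have [] := dF t.
rewrite (@continuous_FTC2 _ _ F _ _ ltr01).
- rewrite /F mulr1 mulr0 addr0 add0r sinD2pi_int -EFinB.
  by rewrite addrK.
- exact: continuous_subspaceT.
- split; first by move=> t _; have [] := dF t.
  + by apply: cvg_at_right_filter; exact: cF.
  + by apply: cvg_at_left_filter; exact: cF.
- by move=> t _; rewrite derive1E; apply: derive_val.
Qed.

Lemma integrable_bounded {dT} {T : measurableType dT} (P : probability T R)
  (f : T -> R) (C : R) :
  measurable_fun setT f -> (forall x, `|f x| <= C) -> P.-integrable setT (EFin \o f).
Proof.
move=> mf fC; apply: measurable_bounded_integrable => //.
  by rewrite (@le_lt_trans _ _ 1%E) ?ltry // probability_le1.
by exists C; split=> [|M CM x _ /=]; [exact: num_real|exact: le_trans (fC x) (ltW CM)].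
Qed.

Lemma integral_prob_cst {dT} {T : measurableType dT} (P : probability T R) (c : R) :
  (\int[P]_x c%:E = c%:E)%E.
Proof.
rewrite integral_cst // -[RHS]mule1; congr (_ * _)%E.
exact: probability_setT.
Qed.

Lemma cos_norm_le1 (t : R) : `|cos t| <= 1.
Proof. by rewrite ler_norml cos_geN1 cos_le1. Qed.

Lemma integral_cos (phi : R) (k : int) :
  (\int[uniform_prob (@ltr01 R)]_t (cos (phi + 2 * pi * k%:~R * t))%:E =
   (if k == 0 then cos phi else 0)%:E)%E.
Proof.
have [->|k0] := eqVneq k 0.
  under eq_integral => t _ do rewrite mulr0 mul0r addr0.
  exact: integral_prob_cst.
have mc : measurable_fun setT (fun t : R => cos (phi + 2 * pi * k%:~R * t)).
  apply: continuous_measurable_fun => t.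
  apply: continuous_comp; last exact: continuous_cos.
  by apply: cvgD; [exact: cvg_cst|exact: cvgMr].
have ic := integrable_bounded (uniform_prob (@ltr01 R)) mc (fun t => cos_norm_le1 _).
have := integral_1cos phi k0.
under eq_integral => t _ do rewrite EFinD.
rewrite integralD //; last first.
  by apply: (integrable_bounded _ (f := cst 1) (C := 1)) => // x; rewrite normr1.
rewrite (integral_prob_cst (uniform_prob (@ltr01 R)) 1).
have := integrable_fin_num measurableT ic.
case: (integral _ _ _) => //= r _ [] h.
by have -> : r = 0 by lra.
Qed.

End exponential_integrals.

Section cube_characters.
Set Implicit Arguments.
Unset Strict Implicit.
Context {R : realType}.
Local Notation point d := (d.-tuple (measurableTypeR R)).

Definition phase d (n : 'rV[int]_d) (x : point d) : R :=
  \sum_(i < d) wavevector R n i 0 * tnth x i.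

Lemma phaseB d (n m : 'rV[int]_d) x : phase (n - m) x = phase n x - phase m x.
Proof.
rewrite /phase -sumrB; apply: eq_bigr => i _; rewrite !mxE rmorphB /=; ring.
Qed.

Lemma measurable_phase d (n : 'rV[int]_d) : measurable_fun setT (phase n).
Proof.
apply: measurable_sum => i; apply: measurable_funM => //; exact: measurable_tnth.
Qed.

Lemma measurable_cos_phase d (n : 'rV[int]_d) (phi : R) :
  measurable_fun setT (fun x => cos (phi + phase n x)).
Proof.
have mD : measurable_fun setT (fun x : point d => phi + phase n x).
  by apply: measurable_funD => //; exact: measurable_phase.
exact: measurableT_comp (continuous_measurable_fun (@continuous_cos R)) mD.
Qed.

Lemma phase_cons d (n : 'rV[int]_d.+1) (p : measurableTypeR R * point d) :
  phase n (cons_pair p) =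
  2 * pi * (n 0 ord0)%:~R * p.1 + phase (\row_i n 0 (lift ord0 i)) p.2.
Proof.
rewrite /phase big_ord_recl !mxE; congr (_ + _).
by apply: eq_bigr => i _; rewrite !mxE tnthS.
Qed.

(** Induction on the dimension: Fubini splits off the first coordinate, whose
    phase joins [phi].  Keeping an arbitrary shift [phi] is what makes the
    induction close, and it also covers the sine. *)
Lemma integral_cos_phase d (n : 'rV[int]_d) (phi : R) :
  (\int[cube_measure R d]_x (cos (phi + phase n x))%:E =
   (if n == 0 then cos phi else 0)%:E)%E.
Proof.
elim: d n phi => [|d IH] n phi.
  have -> : n = 0 by apply/rowP => -[].
  rewrite eqxx; under eq_integral => x _ do rewrite /phase big_ord0 addr0.
  exact: integral_prob_cst.
set n' := \row_i n 0 (lift ord0 i).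
have n0 : (n == 0) = (n 0 ord0 == 0) && (n' == 0).
  apply/eqP/andP => [n_0|[/eqP n00 /eqP n'0]].
    by split; [rewrite n_0 mxE|apply/eqP/rowP => i; rewrite /n' n_0 !mxE].
  apply/rowP => i; rewrite mxE; case: (unliftP ord0 i) => [j ->|->] //.
  by have /rowP/(_ j) := n'0; rewrite !mxE.
have mcp : measurable_fun setT (fun p => cos (phi + phase n (@cons_pair R d p))).
  exact: measurableT_comp (measurable_cos_phase n phi) (@measurable_cons_pair R d).
have icp := integrable_bounded (uniform_prob (@ltr01 R) \x cube_measure R d)%E mcp
  (fun p => cos_norm_le1 _).
rewrite /= integral_distribution; last 2 first.
- by apply/measurable_EFinP; exact: measurable_cos_phase.
- exact: icp.
rewrite -integral12_prod_meas1 /=; last exact: icp.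
rewrite /fubini_F /=.
under eq_integral => t _.
  under eq_integral => q _ do rewrite phase_cons /= addrA.
  rewrite IH. over.
rewrite n0; case: (n' == 0); last by rewrite andbF integral0.
by rewrite andbT integral_cos.
Qed.

End cube_characters.

(** * Real integrals against a probability *)
Section real_integrals.
Set Implicit Arguments.
Unset Strict Implicit.
Context {R : realType} {dT : measure_display} {T : measurableType dT}.
Variable P : probability T R.
Local Notation int f := (P.-integrable setT (EFin \o f)).

Lemma eq_integrableR (f g : T -> R) : f =1 g -> int f -> int g.
Proof. by move=> /funext ->. Qed.

Lemma integrable_mul_bounded (g h : T -> R) (C : R) : int g ->
  measurable_fun setT h -> (forall x, `|h x| <= C) -> int (fun x => g x * h x).
Proof.
move=> ig mh hC; apply: (integrableMl measurableT ig mh).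
by exists C; split=> [|M CM x _ /=]; [exact: num_real|exact: le_trans (hC x) (ltW CM)].
Qed.

Lemma integrable_scale (c : R) (g : T -> R) : int g -> int (fun x => c * g x).
Proof. by move=> ig; exact: (integrableZl measurableT c ig). Qed.

Lemma integrable_sumR (K : Type) (s : seq K) (f : K -> T -> R) :
  (forall k, int (f k)) -> int (fun x => \sum_(k <- s) f k x).
Proof.
move=> fi; have := integrable_sum measurableT s (P := predT) (fun k _ => fi k).
by congr (integrable _ _ _); apply/funext => x /=; rewrite sumEFin.
Qed.

Lemma Rintegral_sum (K : Type) (s : seq K) (f : K -> T -> R) :
  (forall k, int (f k)) ->
  \int[P]_x (\sum_(k <- s) f k x) = \sum_(k <- s) \int[P]_x f k x.
Proof.
move=> fi; elim: s => [|k s IH].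
  rewrite big_nil; under eq_Rintegral => x _ do rewrite big_nil.
  by rewrite Rintegral_cst // mul0r.
rewrite big_cons -IH -RintegralD //; last exact: integrable_sumR.
by apply: eq_Rintegral => x _; rewrite big_cons.
Qed.

(** The difference agrees almost everywhere with its absolute value. *)
Lemma ae_le_Rintegral (f g : T -> R) : int f -> int g ->
  {ae P, forall x, f x <= g x} -> \int[P]_x f x <= \int[P]_x g x.
Proof.
move=> fi gi fg; rewrite -subr_ge0 -RintegralB //.
have gfi : int (g \- f) by apply: (integrableB measurableT gi fi).
rewrite /Rintegral (ae_eq_integral (fun x => `|g x - f x|%:E)) //.
- by apply: fine_ge0; apply: integral_ge0 => x _; rewrite lee_fin.
- by case/integrableP : gfi.
- by have := integrable_norm gfi; case/integrableP.
- by apply: filterS fg => x fgx _; rewrite ger0_norm // subr_ge0.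
Qed.

Lemma ae_eq_Rintegral (f g : T -> R) : int f -> int g ->
  {ae P, forall x, f x = g x} -> \int[P]_x f x = \int[P]_x g x.
Proof.
move=> fi gi fg; apply/eqP; rewrite eq_le; apply/andP; split;
  by apply: ae_le_Rintegral => //; apply: filterS fg => x ->.
Qed.

End real_integrals.

(** * The convolution kernel of an elliptic field *)
Section fourier_kernel.
Set Implicit Arguments.
Unset Strict Implicit.
Local Open Scope complex_scope.
Context {R : realType} {d : nat}.
Local Notation point := (d.-tuple (measurableTypeR R)).
Local Notation I := 'rV[int]_d.
Local Notation Seq := (I -> 'cV[R[i]]_d).
Local Notation P := (cube_measure R d).
Local Notation int f := (P.-integrable setT (EFin \o f)).
Implicit Types (n m : I) (p : point) (x y : 'cV[R[i]]_d).

Lemma measurable_trig_phase n (a b : R) : measurable_fun setT (fun p : point =>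
  a * cos (- phase n p) - b * sin (- phase n p)).
Proof.
have mp : measurable_fun setT (fun p : point => - phase n p).
  by apply: measurableT_comp (measurable_phase n).
apply: measurable_funB; apply: measurable_funM => //.
- exact: measurableT_comp (continuous_measurable_fun (@continuous_cos R)) mp.
- exact: measurableT_comp (continuous_measurable_fun (@continuous_sin R)) mp.
Qed.

Lemma trig_le (a b t : R) : `|a * cos t - b * sin t| <= `|a| + `|b|.
Proof.
apply: le_trans (ler_normB _ _) _; rewrite !normrM.
apply: lerD; rewrite ler_piMr // ler_norml.
- by rewrite cos_geN1 cos_le1.
- by rewrite sin_geN1 sin_le1.
Qed.

Lemma integrable_mul_trig (g : point -> R) n (c : R[i]) : int g ->
  int (fun p => g p * complex.Re (c * cis (- phase n p))).
Proof.
move=> ig; apply: eq_integrableR (integrable_mul_bounded ig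
  (measurable_trig_phase n (complex.Re c) (complex.Im c)) (fun p => trig_le _ _ _)) => p.
by rewrite ReM.
Qed.

Lemma Re_real (r : R) (z : R[i]) : complex.Re (r%:C * z) = r * complex.Re z.
Proof. by rewrite ReM /= mul0r subr0. Qed.

Lemma Im_real (r : R) (z : R[i]) : complex.Im (r%:C * z) = r * complex.Im z.
Proof. by rewrite ImM /= mul0r addr0. Qed.

Lemma fourier_coef_real (g : point -> R) n :
  fourier_coef (fun p => (g p)%:C) n =
  (\int[P]_p (g p * cos (- phase n p))) +i* (\int[P]_p (g p * sin (- phase n p))).
Proof.
rewrite /fourier_coef /torus_cintegral; congr Complex; apply: eq_Rintegral => p _.
  by rewrite Re_real.
by rewrite Im_real.
Qed.

Lemma Re_fourier_coef (g : point -> R) n (c : R[i]) : int g ->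
  complex.Re (c * fourier_coef (fun p => (g p)%:C) n) =
  \int[P]_p (g p * complex.Re (c * cis (- phase n p))).
Proof.
move=> ig.
have ic : int (fun p => g p * cos (- phase n p)).
  by apply: eq_integrableR (integrable_mul_trig n 1 ig) => p; rewrite mul1r.
have is_ : int (fun p => g p * sin (- phase n p)).
  apply: eq_integrableR (integrable_mul_trig n (- 'i) ig) => p.
  by rewrite ReM /= oppr0 mul0r sub0r mulN1r opprK.
rewrite fourier_coef_real ReM /=.
rewrite -!RintegralZl // -RintegralB //; [|exact: integrable_scale..].
by apply: eq_Rintegral => p _; rewrite ReM /=; ring.
Qed.

Definition wave n x p : 'cV[R[i]]_d := cis (phase n p) *: x.

Lemma ip_mulmxE (B : 'M[R[i]]_d) x y : ip x (B *m y) =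
  \sum_(i < d) \sum_(j < d) complex.Re (conjc (x i 0) * y j 0 * B i j).
Proof.
rewrite /ip hermitian_dotE Re_sum; apply: eq_bigr => i _.
rewrite mxE mulr_sumr Re_sum; apply: eq_bigr => j _; congr complex.Re; ring.
Qed.

Lemma ip_wave (b : 'M[R]_d) n m x y p :
  ip (wave n x p) (map_mx (real_complex R) b *m wave m y p) =
  \sum_(i < d) \sum_(j < d) b i j *
    complex.Re (conjc (x i 0) * y j 0 * cis (- phase (n - m) p)).
Proof.
rewrite ip_mulmxE; apply: eq_bigr => i _; apply: eq_bigr => j _.
rewrite !mxE -Re_real phaseB opprB; congr complex.Re.
rewrite /cis sinB cosB; case: (x i 0) (y j 0) => x1 x2 [y1 y2].
by apply/eqP; rewrite eq_complex /=; apply/andP; split; apply/eqP; ring.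
Qed.

Definition integrable_mx (b : point -> 'M[R]_d) := forall i j, int (fun p => b p i j).

Lemma integrable_ip_wave (b : point -> 'M[R]_d) n m x y : integrable_mx b ->
  int (fun p => ip (wave n x p) (map_mx (real_complex R) (b p) *m wave m y p)).
Proof.
move=> ib; apply: eq_integrableR (fun p => esym (ip_wave _ _ _ _ _ _)) _.
do 2 (apply: integrable_sumR => ?); exact: integrable_mul_trig.
Qed.

(** Multiplication by [b] is the convolution with its Fourier coefficients:
    conjugation by a plane wave shifts the frequency. *)
Lemma ip_fourier_mx (b : point -> 'M[R]_d) n m x y : integrable_mx b ->
  ip x (fourier_mx b (n - m) *m y) =
  \int[P]_p ip (wave n x p) (map_mx (real_complex R) (b p) *m wave m y p).
Proof.
move=> ib; rewrite ip_mulmxE.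
under eq_Rintegral do rewrite ip_wave.
rewrite Rintegral_sum => [|i]; last first.
  by apply: integrable_sumR => j; exact: integrable_mul_trig.
apply: eq_bigr => i _; rewrite Rintegral_sum => [|j]; last exact: integrable_mul_trig.
by apply: eq_bigr => j _; rewrite !mxE Re_fourier_coef.
Qed.

Definition trig_poly (F : {fset I}) (u : Seq) p := \sum_(n <- F) wave n (u n) p.

Lemma ip_trig_poly (F : {fset I}) (u : Seq) (B : 'M[R[i]]_d) p :
  ip (trig_poly F u p) (B *m trig_poly F u p) =
  \sum_(n <- F) \sum_(m <- F) ip (wave n (u n) p) (B *m wave m (u m) p).
Proof.
rewrite ipC ip_sumr; apply: eq_bigr => n _.
by rewrite ipC mulmx_sumr ip_sumr.
Qed.

Lemma integrable_form (b : point -> 'M[R]_d) (F : {fset I}) (u : Seq) :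
  integrable_mx b -> int (fun p => ip (trig_poly F u p)
    (map_mx (real_complex R) (b p) *m trig_poly F u p)).
Proof.
move=> ib; apply: eq_integrableR (fun p => esym (ip_trig_poly _ _ _ _)) _.
do 2 (apply: integrable_sumR => ?); exact: integrable_ip_wave.
Qed.

Lemma form_fourier (b : point -> 'M[R]_d) (F : {fset I}) (u : Seq) :
  integrable_mx b ->
  form (fun n m => fourier_mx b (n - m)) F u u =
  \int[P]_p ip (trig_poly F u p) (map_mx (real_complex R) (b p) *m trig_poly F u p).
Proof.
move=> ib; under eq_Rintegral do rewrite ip_trig_poly.
rewrite Rintegral_sum => [|n]; last first.
  by apply: integrable_sumR => m; exact: integrable_ip_wave.
apply: eq_bigr => n _; rewrite Rintegral_sum => [|m]; last exact: integrable_ip_wave.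
by apply: eq_bigr => m _; rewrite ip_fourier_mx.
Qed.

Lemma Rintegral_cos_phase n (phi : R) :
  \int[P]_p cos (phi + phase n p) = if n == 0 then cos phi else 0.
Proof. by rewrite /Rintegral integral_cos_phase. Qed.

Lemma integrable_cstR (c : R) : int (fun=> c).
Proof. by apply: (integrable_bounded P (C := `|c|)). Qed.

Lemma fourier_coef_cst (c : R) n :
  fourier_coef (fun=> c%:C : R[i]) n = if n == 0 then c%:C else 0.
Proof.
have ic phi := integrable_bounded P (measurable_cos_phase n phi) (fun p => cos_norm_le1 _).
rewrite fourier_coef_real !RintegralZl //; last 2 first.
- apply: eq_integrableR (ic (pi / 2)) => p.
  by rewrite sinN addrC cosDpihalf.
- by apply: eq_integrableR (ic 0) => p; rewrite add0r cosN.
have -> : \int[P]_p cos (- phase n p) = \int[P]_p cos (0 + phase n p).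
  by apply: eq_Rintegral => p _; rewrite add0r cosN.
have -> : \int[P]_p sin (- phase n p) = \int[P]_p cos (pi / 2 + phase n p).
  by apply: eq_Rintegral => p _; rewrite sinN addrC cosDpihalf.
rewrite !Rintegral_cos_phase cos0 cos_pihalf.
by case: eqP => _; rewrite ?mulr0 ?mulr1.
Qed.

Lemma fourier_mx1 n :
  fourier_mx (fun=> 1%:M : 'M[R]_d) n = if n == 0 then 1%:M else 0.
Proof.
apply/matrixP => i j; rewrite mxE fourier_coef_cst.
by case: ifP => _; rewrite !mxE // rmorph_nat.
Qed.

Lemma integrable_mx1 : integrable_mx (fun=> 1%:M : 'M[R]_d).
Proof. by move=> i j; exact: integrable_cstR. Qed.

(** Parseval's identity for trigonometric polynomials: the case [b = 1] of
    [form_fourier], where only the diagonal coefficients survive. *)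
Lemma Rintegral_sq_trig_poly (F : {fset I}) (u : Seq) :
  \int[P]_p sq (trig_poly F u p) = \sum_(n <- F) sq (u n).
Proof.
have := form_fourier F u integrable_mx1.
under eq_Rintegral do rewrite map_mx1 mul1mx.
move=> <-; rewrite /form [LHS]big_seq [RHS]big_seq; apply: eq_bigr => n nF.
rewrite (big_fsetD1 n) //= subrr fourier_mx1 eqxx mul1mx.
rewrite big_seq big1 ?addr0 // => m; rewrite !inE => /andP[mn _].
by rewrite fourier_mx1 subr_eq0 eq_sym (negbTE mn) mul0mx ip0r.
Qed.

Lemma integrable_sq_trig_poly (F : {fset I}) (u : Seq) :
  int (fun p => sq (trig_poly F u p)).
Proof.
apply: eq_integrableR (integrable_form F u integrable_mx1) => p.
by rewrite map_mx1 mul1mx.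
Qed.

Lemma dotvE (v w : 'cV[R]_d) : dotv v w = \sum_(i < d) v i 0 * w i 0.
Proof. by rewrite /dotv mxE; apply: eq_bigr => i _; rewrite mxE. Qed.

Lemma ip_real_mx (B : 'M[R]_d) x :
  ip x (map_mx (real_complex R) B *m x) =
  dotv (map_mx (@complex.Re R) x) (B *m map_mx (@complex.Re R) x) +
  dotv (map_mx (@complex.Im R) x) (B *m map_mx (@complex.Im R) x).
Proof.
rewrite ip_mulmxE !dotvE -big_split; apply: eq_bigr => i _ /=.
rewrite !mxE !mulr_sumr -big_split; apply: eq_bigr => j _ /=.
rewrite !mxE; case: (x i 0) (x j 0) => ? ? [? ?] /=; ring.
Qed.

Lemma sq_real x : sq x = dotv (map_mx (@complex.Re R) x) (map_mx (@complex.Re R) x) +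
  dotv (map_mx (@complex.Im R) x) (map_mx (@complex.Im R) x).
Proof.
have := ip_real_mx 1%:M x; by rewrite map_mx1 !mul1mx.
Qed.

Lemma Linfty_integrable_mx (a : point -> 'M[R]_d) :
  torus_Linfty_mx a -> integrable_mx a.
Proof.
move=> [_ aL] i j; apply/Lfun1_integrable.
have Pfin : P [set: point] \is a fin_num.
  exact: (fin_num_measure P _ measurableT).
have l1 : (1 <= 1 :> \bar R)%E by [].
have ly : (1 <= +oo :> \bar R)%E by exact: leey.
have sub := @Lfun_subset _ _ R P 1%E +oo%E l1 ly Pfin ly.
by have := sub _ (aL i j).
Qed.

Variable a : point -> 'M[R]_d.
Hypothesis aL : torus_Linfty_mx a.

Lemma fourier_hermitian : symmetric_field a ->
  hermitian_kernel (fun n m => fourier_mx a (n - m)).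
Proof.
have ia := Linfty_integrable_mx aL.
move=> asym n m x y; rewrite (ip_fourier_mx n m x y ia) (ip_fourier_mx m n y x ia).
apply: ae_eq_Rintegral; [exact: integrable_ip_wave..|].
apply: filterS asym => p ap; rewrite !ip_wave exchange_big /=.
apply: eq_bigr => j _; apply: eq_bigr => i _.
rewrite -{1}ap mxE; congr (_ * _).
rewrite !phaseB !opprB -[phase m p - _]opprB /cis cosN sinN.
by case: (x i 0) (y j 0) => ? ? [? ?] /=; ring.
Qed.

Lemma fourier_bounds (lambda Lambda : R) : elliptic_field lambda Lambda a ->
  form_bounds (fun n m => fourier_mx a (n - m)) lambda^-1 Lambda.
Proof.
have ia := Linfty_integrable_mx aL.
move=> ell F u; rewrite form_fourier // -Rintegral_sq_trig_poly.
have isq := integrable_sq_trig_poly F u.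
rewrite -!RintegralZl //; apply/andP; split; apply: ae_le_Rintegral => //.
- exact: integrable_scale.
- exact: integrable_form.
- apply: filterS ell => p ap; rewrite ip_real_mx sq_real mulrDr.
  by apply: lerD; [have /andP[] := ap (map_mx (@complex.Re R) (trig_poly F u p))|
                   have /andP[] := ap (map_mx (@complex.Im R) (trig_poly F u p))].
- exact: integrable_form.
- exact: integrable_scale.
- apply: filterS ell => p ap; rewrite ip_real_mx sq_real mulrDr.
  by apply: lerD; [have /andP[] := ap (map_mx (@complex.Re R) (trig_poly F u p))|
                   have /andP[] := ap (map_mx (@complex.Im R) (trig_poly F u p))].
Qed.

End fourier_kernel.

(** * The multiplier as an orthogonal projection *)
Section leray_multiplier.
Set Implicit Arguments.
Unset Strict Implicit.
Local Open Scope complex_scope.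
Context {R : realType} {d : nat}.
Local Notation I := 'rV[int]_d.
Implicit Types (n : I) (v w : 'cV[R]_d) (x y : 'cV[R[i]]_d).

Lemma ip_symmetric_mx (B : 'M[R]_d) x y : B^T = B ->
  ip x (map_mx (real_complex R) B *m y) = ip y (map_mx (real_complex R) B *m x).
Proof.
move=> Bsym; rewrite !ip_mulmxE exchange_big /=.
apply: eq_bigr => j _; apply: eq_bigr => i _; rewrite -{1}Bsym !mxE.
by case: (x i 0) (y j 0) => ? ? [? ?] /=; ring.
Qed.

Lemma multiplier_mx_sym n : (multiplier_mx R n)^T = multiplier_mx R n.
Proof.
apply/matrixP => i j; rewrite !mxE eq_sym; congr (_ - _).
by case: ifP => // _; rewrite [X in X / _]mulrC.
Qed.

Lemma wavevector_neq0 n : n != 0 -> 0 < dotv (wavevector R n) (wavevector R n).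
Proof.
move=> n0; rewrite lt0r dotvE sumr_ge0 ?andbT => [|i _]; last by rewrite -expr2 sqr_ge0.
apply: contra n0; rewrite psumr_eq0 => [/allP kz|i _]; last by rewrite -expr2 sqr_ge0.
apply/eqP/rowP => i; have := kz i (mem_index_enum i).
rewrite /= -expr2 sqrf_eq0 !mxE !mulf_eq0 pnatr_eq0 (gt_eqF (pi_gt0 R)) /=.
by rewrite intr_eq0 => /eqP.
Qed.

(** Off the zero frequency the multiplier is the orthogonal projection onto
    the complement of [k], whose quadratic form is [|v - t k|^2] with
    [t = (k . v) / |k|^2]. *)
Lemma multiplier_mx_bounds n v :
  0 <= dotv v (multiplier_mx R n *m v) <= dotv v v.
Proof.
have v0 : 0 <= dotv v v by rewrite dotvE sumr_ge0 // => i _; rewrite -expr2 sqr_ge0.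
have [n0|n0] := eqVneq n 0.
  rewrite (_ : multiplier_mx R n = 1%:M) ?mul1mx ?v0 ?lexx //.
  by apply/matrixP => i j; rewrite !mxE n0 eqxx subr0.
have k0 := wavevector_neq0 n0; set k := wavevector R n in k0 *.
pose t := dotv k v / dotv k k.
have pv : multiplier_mx R n *m v = v - t *: k.
  apply/matrixP => i j; rewrite ord1 !mxE.
  under eq_bigr => l _ do rewrite mxE (negbTE n0) mulrBl.
  rewrite big_split /= (bigD1 i) //= eqxx mul1r big1 ?addr0; last first.
    by move=> l li; rewrite eq_sym (negbTE li) mul0r.
  congr (_ + _); rewrite sumrN; congr (- _).
  have -> : 2 * pi * (n 0 i)%:~R = k i 0 by rewrite mxE.
  rewrite {1}/t (dotvE k v) !mulr_suml; apply: eq_bigr => l _.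
  by rewrite -/k; ring.
have E : dotv v (v - t *: k) = dotv v v - t * dotv k v.
  rewrite !dotvE mulr_sumr -sumrB; apply: eq_bigr => i _; rewrite !mxE; ring.
have E2 : dotv v v - t * dotv k v = dotv (v - t *: k) (v - t *: k).
  have -> : dotv (v - t *: k) (v - t *: k) =
      dotv v v - 2 * t * dotv k v + t ^+ 2 * dotv k k.
    rewrite !dotvE !mulr_sumr -sumrB -big_split; apply: eq_bigr => i _ /=.
    rewrite !mxE; ring.
  by rewrite /t; field; rewrite gt_eqF.
rewrite pv E; apply/andP; split.
  by rewrite E2 dotvE sumr_ge0 // => i _; rewrite -expr2 sqr_ge0.
by rewrite gerBl /t mulrAC -expr2 divr_ge0 ?sqr_ge0 // ltW.
Qed.

Lemma ip_multiplier_bounds n x :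
  0 <= ip x (map_mx (real_complex R) (multiplier_mx R n) *m x) <= sq x.
Proof.
rewrite ip_real_mx sq_real.
have /andP[r0 r1] := multiplier_mx_bounds n (map_mx (@complex.Re R) x).
have /andP[i0 i1] := multiplier_mx_bounds n (map_mx (@complex.Im R) x).
by rewrite addr_ge0 //= lerD.
Qed.

End leray_multiplier.

(** * Absolutely convergent complex series *)
Section complex_series.
Set Implicit Arguments.
Unset Strict Implicit.
Local Open Scope complex_scope.
Context {R : realType} {I : choiceType}.
Implicit Types (f : I -> R[i]) (F : {fset I}) (C : R).

Lemma normc_ge0 (z : R[i]) : 0 <= Normc.normc z.
Proof. by case: z => a b; exact: sqrtr_ge0. Qed.

Lemma normc_ge_Re (z : R[i]) : `|complex.Re z| <= Normc.normc z.
Proof.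
by case: z => a b /=; rewrite -sqrtr_sqr ler_wsqrtr // lerDl sqr_ge0.
Qed.

Lemma normc_ge_Im (z : R[i]) : `|complex.Im z| <= Normc.normc z.
Proof.
by case: z => a b /=; rewrite -sqrtr_sqr ler_wsqrtr // lerDr sqr_ge0.
Qed.

Lemma normc_le_ReIm (z : R[i]) :
  Normc.normc z <= `|complex.Re z| + `|complex.Im z|.
Proof.
rewrite -(ler_pXn2r (n := 2)) ?nnegrE ?normc_ge0 ?addr_ge0 //.
rewrite normc_sqr -(real_normK (num_real (complex.Re z))).
rewrite -(real_normK (num_real (complex.Im z))).
by have := mulr_ge0 (normr_ge0 (complex.Re z)) (normr_ge0 (complex.Im z)); nra.
Qed.

Lemma abs_summable_le f C :
  (forall F, \sum_(i <- F) Normc.normc (f i) <= C) -> abs_summable f.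
Proof.
move=> fC; apply: le_lt_trans (ltry C).
rewrite (eq_esum (b := fun i => (Normc.normc (f i))%:E)) => [|i _]; first exact: esum_le.
by rewrite gee0_abs // lee_fin normc_ge0.
Qed.

Lemma csum_has_sum f C (c : R[i]) :
  (forall F, \sum_(i <- F) Normc.normc (f i) <= C) ->
  has_sum (fun i => complex.Re (c * f i)) (complex.Re (c * csum f)).
Proof.
move=> fC.
have hR : has_sum (fun i => complex.Re (f i)) (complex.Re (csum f)).
  apply: (abs_has_sum (C := C)) => F; apply: le_trans (fC F).
  by apply: ler_sum => i _; exact: normc_ge_Re.
have hI : has_sum (fun i => complex.Im (f i)) (complex.Im (csum f)).
  apply: (abs_has_sum (C := C)) => F; apply: le_trans (fC F).
  by apply: ler_sum => i _; exact: normc_ge_Im.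
rewrite ReM; apply: eq_has_sum (has_sumB (has_sumZ (complex.Re c) hR)
  (has_sumZ (complex.Im c) hI)) => i.
by rewrite ReM.
Qed.

End complex_series.

(** * The kernel of the preconditioned operator *)
Section preconditioned_operator.
Set Implicit Arguments.
Unset Strict Implicit.
Local Open Scope complex_scope.
Context {R : realType} {d : nat}.
Local Notation point := (d.-tuple (measurableTypeR R)).
Local Notation I := 'rV[int]_d.
Local Notation Seq := (I -> 'cV[R[i]]_d).
Implicit Types (n m : I) (u v psi : Seq) (F : {fset I}) (e x y : 'cV[R[i]]_d).
Variables (mu lambda Lambda : R) (a : point -> 'M[R]_d).
Hypotheses (mu0 : 0 < mu) (lambda1 : 1 < lambda) (Lambda1 : 1 < Lambda).
Hypotheses (aL : torus_Linfty_mx a) (asym : symmetric_field a).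
Hypothesis aell : elliptic_field lambda Lambda a.

Let lambda0 : 0 < lambda. Proof. exact: lt_trans lambda1. Qed.
Let alpha0 : 0 < lambda^-1. Proof. by rewrite invr_gt0. Qed.
Let alpha_Lambda : lambda^-1 <= Lambda.
Proof. by apply/ltW; apply: lt_trans Lambda1; rewrite invf_lt1. Qed.
Let alpha_beta : lambda^-1 <= mu + Lambda.
Proof. by apply: le_trans alpha_Lambda _; rewrite lerDr ltW. Qed.

Definition conv_kernel n m := fourier_mx a (n - m).

Definition precond_kernel n m : 'M[R[i]]_d := conv_kernel n m +
  (if n == m then mu%:C *: map_mx (real_complex R) (multiplier_mx R n) else 0).

Lemma ip_precond_kernel n m x y : ip x (precond_kernel n m *m y) =
  ip x (conv_kernel n m *m y) + (if n == m then mu *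
    ip x (map_mx (real_complex R) (multiplier_mx R n) *m y) else 0).
Proof.
rewrite /precond_kernel mulmxDl ipDr; congr (_ + _).
by case: ifP => _; rewrite ?mul0mx ?ip0r // -scalemxAl ipZr.
Qed.

Lemma precond_hermitian : hermitian_kernel precond_kernel.
Proof.
move=> n m x y; rewrite !ip_precond_kernel [in LHS](fourier_hermitian aL asym).
congr (_ + _); rewrite eq_sym; case: eqP => // ->.
by rewrite (ip_symmetric_mx _ _ (multiplier_mx_sym n)).
Qed.

Lemma precond_bounds : form_bounds precond_kernel lambda^-1 (mu + Lambda).
Proof.
move=> F u; have /andP[lo hi] := fourier_bounds aL aell F u.
have -> : form precond_kernel F u u = form conv_kernel F u u +
    mu * \sum_(n <- F) ip (u n) (map_mx (real_complex R) (multiplier_mx R n) *m u n).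
  rewrite /form mulr_sumr -big_split big_seq [RHS]big_seq; apply: eq_bigr => n nF /=.
  under eq_bigr do rewrite ip_precond_kernel.
  rewrite big_split /=; congr (_ + _).
  rewrite (big_fsetD1 n) //= eqxx big_seq big1 ?addr0 // => m.
  by rewrite !inE eq_sym => /andP[/negbTE ->].
have p0 : 0 <= \sum_(n <- F)
    ip (u n) (map_mx (real_complex R) (multiplier_mx R n) *m u n).
  by apply: sumr_ge0 => n _; have /andP[] := ip_multiplier_bounds n (u n).
have p1 : \sum_(n <- F) ip (u n) (map_mx (real_complex R) (multiplier_mx R n) *m u n)
    <= \sum_(n <- F) sq (u n).
  by apply: ler_sum => n _; have /andP[] := ip_multiplier_bounds n (u n).
rewrite (le_trans lo) ?lerDl ?mulr_ge0 ?(ltW mu0) //=.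
by rewrite mulrDl addrC lerD // ler_pM2l.
Qed.

Lemma ip_delta i y : ip (delta_mx i 0) y = complex.Re (y i 0).
Proof.
rewrite ipE (bigD1 i) //= big1 => [|j ji]; rewrite !mxE ?eqxx /=.
  by rewrite mul1r mul0r !addr0.
by rewrite (negbTE ji) /= !mul0r addr0.
Qed.

Lemma ip_idelta i y : ip ('i *: delta_mx i 0) y = complex.Im (y i 0).
Proof.
rewrite ipE (bigD1 i) //= big1 => [|j ji]; rewrite !mxE ?eqxx !ReM !ImM /=.
  by rewrite addr0; ring.
by rewrite (negbTE ji) /=; ring.
Qed.

(** The real and imaginary parts of the terms are entries of a row of the kernel
    applied to the [j]-th coordinate of [psi], tested against the [i]-th basis
    vector and its multiple by the imaginary unit. *)
Lemma conv_term_sum_le psi n i j : l2 psi -> exists C : R, forall F,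
  \sum_(m <- F) Normc.normc (conv_term (fourier_mx a) psi n i j m) <= C.
Proof.
move=> lpsi; pose y : Seq := fun m => psi m j 0 *: delta_mx j 0.
have ly : l2 y.
  apply: (l2_le (C := l2sq psi)) => F; apply: le_trans (l2_ge F lpsi).
  apply: ler_sum => m _; rewrite sqZ {1}/sq ip_delta mxE !eqxx mulr1.
  rewrite sqE (bigD1 j) //= lerDl; apply: sumr_ge0 => k _; exact: sqr_ge0.
have yE m : (conv_kernel n m *m y m) i 0 = conv_term (fourier_mx a) psi n i j m.
  by rewrite /y -scalemxAr -colE !mxE /conv_term mulrC !mxE.
have row e F := kernel_row_le (fourier_hermitian aL asym)
  (fourier_bounds aL aell) alpha0 alpha_Lambda n e F ly.
eexists => F; apply: le_trans (ler_sum _ (fun m _ => normc_le_ReIm _)) _.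
rewrite big_split /=; under eq_bigr do rewrite -yE -ip_delta.
under [X in _ + X]eq_bigr do rewrite -yE -ip_idelta.
exact: lerD (row _ F) (row _ F).
Qed.

Lemma conv_represents : represents conv_kernel (discrete_conv (fourier_mx a)).
Proof.
move=> u n e lu.
rewrite {2}/ip hermitian_dotE Re_sum.
under [X in has_sum _ X]eq_bigr do rewrite mxE mulr_sumr Re_sum.
apply: (eq_has_sum (f := fun m => \sum_(i < d) \sum_(j < d)
    complex.Re (conjc (e i 0) * conv_term (fourier_mx a) u n i j m))) => [m|].
  rewrite ip_mulmxE; apply: eq_bigr => i _; apply: eq_bigr => j _.
  by rewrite /conv_term /conv_kernel; congr complex.Re; ring.
apply: has_sum_sum => i; apply: has_sum_sum => j.
by have [C HC] := conv_term_sum_le n i j lu; exact: csum_has_sum HC.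
Qed.

Local Notation T := (precond_op a mu).

Lemma precond_represents : represents precond_kernel T.
Proof.
move=> u n e lu.
have -> : T u n = discrete_conv (fourier_mx a) u n +
  mu%:C *: (map_mx (real_complex R) (multiplier_mx R n) *m u n) by [].
rewrite ipDr ipZr.
have := has_sum_fset [fset n]%fset
  (fun m => mu * ip e (map_mx (real_complex R) (multiplier_mx R n) *m u m)).
rewrite big_seq_fset1 => h.
apply: eq_has_sum (has_sumD (@conv_represents u n e lu) h) => m.
by rewrite ip_precond_kernel inE eq_sym.
Qed.

End preconditioned_operator.

(** * Symmetry, positivity and norms on l2 *)
Section operator_properties.
Set Implicit Arguments.
Unset Strict Implicit.
Local Open Scope complex_scope.
Context {R : realType} {d : nat}.
Local Notation Seq := ('rV[int]_d -> 'cV[R[i]]_d).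
Implicit Types (u v : Seq) (r : R).
Variables (T : Seq -> Seq) (alpha beta : R).
Hypothesis alpha0 : 0 < alpha.
Hypothesis alpha_beta : alpha <= beta.
Hypothesis Tl2 : forall u, l2 u -> l2 (T u).
Hypothesis Tlin : l2_linear T.
Hypothesis Tsym : forall u v, l2 u -> l2 v -> dot (T u) v = dot u (T v).
Hypothesis Tbound : forall u, l2 u -> l2sq (T u) <= beta ^+ 2 * l2sq u.
Hypothesis Tcoer : forall u, l2 u -> alpha * l2sq u <= dot u (T u).

Lemma l2_dotE u v : l2_dot u v = dot u v +i* dot u (- 'i *: v).
Proof.
congr Complex; congr rsum; apply/funext => n.
by rewrite Im_hermitian_dot.
Qed.

Lemma symmetric_l2_symmetric : l2_symmetric T.
Proof.
move=> u v lu lv; have liv := l2Z (- 'i) lv.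
by rewrite !l2_dotE (Tsym lu lv) (Tsym lu liv) (l2_linearZ (- 'i) Tlin lv).
Qed.

Lemma dot_NiC u v : l2 u -> l2 v -> dot u (- 'i *: v) = - dot v (- 'i *: u).
Proof.
move=> lu lv; rewrite -[RHS]mulN1r -(dotZr (-1) lv (l2Z (- 'i) lu)).
congr rsum; apply/funext => n.
rewrite !ipE; apply: eq_bigr => i _; rewrite !mxE !ReM !ImM /=.
ring.
Qed.

(** The imaginary part of [<u, T u>] equals its opposite, by symmetry of [T]
    and complex linearity. *)
Lemma coercive_l2_posdef : l2_posdef T.
Proof.
move=> u lu u0; rewrite l2_dotE ltcE /=; apply/andP; split.
  have liu := l2Z (- 'i) lu.
  have := dot_NiC lu (Tl2 lu); rewrite (Tsym lu liu) (l2_linearZ (- 'i) Tlin lu) => h.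
  by apply/eqP; lra.
apply: lt_le_trans (Tcoer lu); rewrite mulr_gt0 // ltNge.
by apply: contra u0 => /(l2sq_eq0 lu) ->.
Qed.

Lemma l2_norm_le1 u : (l2_norm u <= 1)%E -> l2 u /\ l2sq u <= 1.
Proof.
move=> u1; have lu : l2 u by apply: le_lt_trans u1 (ltry _).
split=> //; move: u1; rewrite (l2_norm_l2sq lu) lee_fin => u1.
by rewrite -(sqr_sqrtr (l2sq_ge0 u)) expr_le1 // sqrtr_ge0.
Qed.

Lemma op_norm_ge0 (S : Seq -> Seq) : (0 <= op_norm S)%E.
Proof.
apply: ereal_sup_ge; exists (l2_norm (S 0)); last by rewrite l2_normE sqrte_ge0.
exists 0 => //=; apply: (l2_norm_le (c := 1)) => // F.
by rewrite big1 ?expr1n // => n _; exact: sq0.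
Qed.

Lemma op_norm_le (S : Seq -> Seq) (c : R) : 0 <= c ->
  (forall u, l2 u -> l2 (S u) /\ l2sq (S u) <= c ^+ 2 * l2sq u) ->
  (op_norm S <= c%:E)%E.
Proof.
move=> c0 Sc; apply: ge_ereal_sup => _ [u /l2_norm_le1[lu u1] <-].
have [lS Su] := Sc u lu; apply: l2_norm_le => // F.
apply: le_trans (l2_ge F lS) (le_trans Su _).
by rewrite -[leRHS]mulr1 ler_wpM2l ?sqr_ge0.
Qed.

Lemma bounded_op_norm : (op_norm T <= beta%:E)%E.
Proof.
apply: op_norm_le => [|u lu]; first exact: le_trans (ltW alpha0) alpha_beta.
by split; [exact: Tl2|exact: Tbound].
Qed.

Lemma coercive_bij : set_bij (@l2 R d) (@l2 R d) T.
Proof.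
split=> //.
- by move=> u v /set_mem lu /set_mem lv; exact: (coercive_injective alpha0 Tl2 Tlin Tcoer).
- move=> f lf.
  have [u lu <-] := coercive_surjective alpha0 alpha_beta Tl2 Tlin Tbound Tcoer lf.
  by exists u.
Qed.

(** The inverse inherits [alpha |u| <= |T u|]. *)
Lemma inv_op_norm : (op_norm (l2_inv T) <= (alpha^-1)%:E)%E.
Proof.
apply: op_norm_le => [|f lf]; first by rewrite invr_ge0 ltW.
have [_ Tinj Tsurj] := coercive_bij.
have [u lu <-] := Tsurj f lf.
rewrite /l2_inv pinvKV ?inE //.
split=> //; rewrite -(ler_pM2l (exprn_gt0 2 alpha0)) mulrA -exprMn.
rewrite divff ?gt_eqF // expr1n mul1r.
exact: (coercive_bounded_below alpha0 Tl2 Tcoer).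
Qed.

End operator_properties.

Theorem proposition4p1 (R : realType) (d : nat) (mu lambda Lambda : R)
    (a : d.-tuple (measurableTypeR R) -> 'M[R]_d)
    (hmu : 0 < mu) (hlambda : 1 < lambda) (hLambda : 1 < Lambda)
    (ha : torus_Linfty_mx a) (hsym : symmetric_field a)
    (hellip : elliptic_field lambda Lambda a) :
  let T := precond_op a mu in
  (* the convolution series converge absolutely, and T is an operator on l2 *)
  (forall psi n i j, l2 psi ->
     abs_summable (conv_term (fourier_mx a) psi n i j)) /\
  l2_operator T /\
  l2_symmetric T /\
  l2_posdef T /\
  l2_bounded T /\
  l2_invertible T /\
  (condition_number T <= (lambda * (mu + Lambda))%:E)%E.
Proof.
move=> T.
have lambda0 : 0 < lambda by exact: lt_trans hlambda.
have alpha0 : 0 < lambda^-1 by rewrite invr_gt0.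
have alpha_beta : lambda^-1 <= mu + Lambda.
  apply: (@le_trans _ _ 1); first by rewrite invf_le1 // ltW.
  by rewrite ler_wpDl // ltW.
have Mrep : represents (precond_kernel mu a) T.
  exact: precond_represents hlambda hLambda ha hsym hellip.
have Mherm : hermitian_kernel (precond_kernel mu a) by exact: precond_hermitian.
have Mbnd := precond_bounds hmu ha hellip.
have Tl2 := op_l2 Mherm Mbnd alpha0 alpha_beta Mrep.
have Tlin := op_linear Mrep.
have Tbound := op_l2sq_le Mherm Mbnd alpha0 alpha_beta Mrep.
have Tsym := op_symmetric Mherm Mbnd alpha0 alpha_beta Mrep.
have Tcoer := op_coercive Mherm Mbnd alpha0 alpha_beta Mrep.
have Tnorm := bounded_op_norm alpha0 alpha_beta Tl2 Tbound.
have Tinv := inv_op_norm alpha0 alpha_beta Tl2 Tlin Tbound Tcoer.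
rewrite invrK in Tinv.
split; [|split; [|split; [|split; [|split; [|split]]]]].
- move=> psi n i j lpsi.
  have [C HC] := conv_term_sum_le hlambda hLambda ha hsym hellip n i j lpsi.
  exact: abs_summable_le HC.
- by split.
- exact: (symmetric_l2_symmetric Tlin Tsym).
- exact: (coercive_l2_posdef alpha0 Tl2 Tlin Tsym Tcoer).
- by apply: le_lt_trans Tnorm _; rewrite ltry.
- split; first exact: (coercive_bij alpha0 alpha_beta Tl2 Tlin Tbound Tcoer).
  by apply: le_lt_trans Tinv _; rewrite ltry.
- rewrite /condition_number mulrC EFinM.
  by apply: lee_pmul => //; exact: op_norm_ge0.
Qed.
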